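(* Let $K$ be an algebraically closed field, let $G$ be any semigroup, and let $A$ and $B$ be finite-dimensional $G$-graded algebras over $K$ which are graded simple. Then $A$ and $B$ are isomorphic as $G$-graded algebras if and only if they satisfy the same $G$-graded polynomial identities.
   Context: An algebra over $K$ is a $K$-vector space with one bilinear product $(x,y)\mapsto xy$; associativity is not assumed. A $G$-grading on $A$ is a vector space decomposition $A=\bigoplus_{g\in G}A_g$ with $A_gA_h\subset A_{gh}$ for all $g,h\in G$. A homomorphism of $G$-graded algebras $\varphi:A\to B$ is an algebra homomorphism with $\varphi(A_g)\subset B_g$ for all $g\in G$; an isomorphism of $G$-graded algebras is a bijective such homomorphism. A two-sided ideal $I$ of $A$ is $G$-graded if $I=\bigoplus_{g\in G}(I\cap A_g)$. $A$ is graded simple if $AA\neq 0$ and its only $G$-graded two-sided ideals are $0$ and $A$. Let $X$ be a countably infinite set and let $K\langle X^G\rangle$ be the free non-associative algebra with free generators $x^{(g)}$, $x\in X$, $g\in G$. An element $f\in K\langle X^G\rangle$ is a $G$-graded polynomial identity of $A$ if $f$ vanishes under every evaluation sending each $x^{(g)}$ to an element of $A_g$. *)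

(* Defs.v *)
From HB Require Import structures.
From mathcomp Require Import all_boot all_order all_algebra.
From mathcomp Require Import finmap monalg.

Set Implicit Arguments.
Unset Strict Implicit.
Unset Printing Implicit Defensive.

Import GRing.Theory.

Local Open Scope ring_scope.

(* Algebras have one bilinear product; neither associativity nor a unit is
   required. *)
Definition alg_morph (K : fieldType) (U V : lmodType K)
    (mulU : {bilinear U -> U -> U}) (mulV : {bilinear V -> V -> V})
    (phi : U -> V) : Prop :=
  {morph phi : x y / mulU x y >-> mulV x y}.

(* U is the internal direct sum of the subspaces W g. The index type may be
   infinite: the sum is spanned by finite sums, and directness is a condition on
   finite sets of indices. *)
Definition is_direct_sum (K : fieldType) (V : vectType K) (I : eqType)
    (U : {vspace V}) (W : I -> {vspace V}) : Prop :=
  [/\ forall g, (W g <= U)%VS,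
      forall u, u \in U -> exists s : seq I, u \in (\sum_(g <- s) W g)%VS
    & forall s : seq I, uniq s -> directv (\sum_(g <- s) W g)].

(* Being a vectType, the carrier is finite dimensional. *)
Record gradedAlg (K : fieldType) (G : semigroupType) := GradedAlg {
  ga_sort :> vectType K;
  ga_mul : {bilinear ga_sort -> ga_sort -> ga_sort};
  ga_comp : G -> {vspace ga_sort};
  ga_direct : is_direct_sum fullv ga_comp;
  ga_compM : forall (g h : G) (x y : ga_sort),
    x \in ga_comp g -> y \in ga_comp h -> ga_mul x y \in ga_comp (g * h)%g
}.

Section GradedAlgebras.
Variables (K : fieldType) (G : semigroupType).
Implicit Types A B : gradedAlg K G.

Definition graded_morph A B (phi : {linear A -> B}) : Prop :=
  alg_morph (ga_mul A) (ga_mul B) phi /\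
  forall (g : G) (x : A), x \in ga_comp A g -> phi x \in ga_comp B g.

Definition graded_iso A B : Prop :=
  exists2 phi : {linear A -> B}, graded_morph phi & bijective phi.

Definition two_sided_ideal A (I : {vspace A}) : Prop :=
  forall x y : A, x \in I -> ga_mul A x y \in I /\ ga_mul A y x \in I.

Definition graded_ideal A (I : {vspace A}) : Prop :=
  two_sided_ideal I /\ is_direct_sum I (fun g => I :&: ga_comp A g)%VS.

Definition graded_simple A : Prop :=
  (exists x y : A, ga_mul A x y != 0) /\
  forall I : {vspace A}, graded_ideal I -> I = 0%VS \/ I = fullv.

End GradedAlgebras.

(* Nonassociative monomials: the free magma on T. *)
Inductive fmagma (T : Type) : Type :=
| FGen of T
| FMul of fmagma T & fmagma T.

Section FMagmaChoice.
Variable T : choiceType.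

Fixpoint fmagma_encode (m : fmagma T) : GenTree.tree T :=
  match m with
  | FGen t => GenTree.Leaf t
  | FMul m1 m2 => GenTree.Node 0 [:: fmagma_encode m1; fmagma_encode m2]
  end.

Fixpoint fmagma_decode (t : GenTree.tree T) : option (fmagma T) :=
  match t with
  | GenTree.Leaf t => Some (FGen t)
  | GenTree.Node _ [:: t1; t2] =>
      if (fmagma_decode t1, fmagma_decode t2) is (Some m1, Some m2)
      then Some (FMul m1 m2) else None
  | _ => None
  end.

Lemma fmagma_encodeK : pcancel fmagma_encode fmagma_decode.
Proof. by elim=> [t|m1 IH1 m2 IH2] //=; rewrite IH1 IH2. Qed.

HB.instance Definition _ := Choice.copy (fmagma T) (pcan_type fmagma_encodeK).

End FMagmaChoice.

(* The free nonassociative algebra on T has the nonassociative monomials as a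
   basis; it has no unit. *)
Notation freeNA K T := {malg K[fmagma T]}.

Section FreeAlgebra.
Variables (K : fieldType) (T : choiceType).
Implicit Types f g : freeNA K T.

Definition free_gen (t : T) : freeNA K T := << FGen t >>.

(* The linear map with prescribed values on monomials. *)
Definition mextend (V : lmodType K) (v : fmagma T -> V) f : V :=
  \sum_(m <- msupp f) f@_m *: v m.

Definition free_mul f g : freeNA K T :=
  mextend (fun m => mextend (fun n => << FMul m n >>) g) f.

Lemma mextendEw (V : lmodType K) (v : fmagma T -> V) f (d : {fset fmagma T}) :
  (msupp f `<=` d)%fset -> mextend v f = \sum_(m <- d) f@_m *: v m.
Proof.
move=> fd; rewrite /mextend; apply: big_fset_incl => // m _ /mcoeff_outdom ->.
by rewrite scale0r.
Qed.

Lemma mextend_linear (V : lmodType K) (v : fmagma T -> V) :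
  linear (mextend v).
Proof.
move=> a f g.
set d := (msupp (a *: f + g) `|` (msupp f `|` msupp g))%fset.
have fd : (msupp f `<=` d)%fset by rewrite fsubsetU // fsubsetUl orbT.
have gd : (msupp g `<=` d)%fset by rewrite fsubsetU // fsubsetUr orbT.
rewrite (mextendEw v (fsubsetUl _ _ : (_ `<=` d)%fset)).
rewrite (mextendEw v fd) (mextendEw v gd) scaler_sumr -big_split /=.
by apply: eq_bigr => m _; rewrite mcoeffD mcoeffZ scalerDl scalerA.
Qed.

HB.instance Definition _ (V : lmodType K) (v : fmagma T -> V) :=
  GRing.isLinear.Build K (freeNA K T) V *:%R (mextend v) (mextend_linear v).

Lemma mextendU (V : lmodType K) (v : fmagma T -> V) m : mextend v << m >> = v m.
Proof.
by rewrite /mextend msuppU oner_eq0 big_seq_fset1 mcoeffUU scale1r.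
Qed.

Lemma mextend_comb (V : lmodType K) (a : K) (v w : fmagma T -> V) f :
  mextend (fun m => a *: v m + w m) f = a *: mextend v f + mextend w f.
Proof.
rewrite /mextend scaler_sumr -big_split /=; apply: eq_bigr => m _.
by rewrite scalerDr !scalerA mulrC.
Qed.

Lemma free_mul_bilinear : bilinear_for *:%R *:%R free_mul.
Proof.
split=> [g|f] a x y; first exact: linearP.
rewrite /free_mul -mextend_comb.
by apply: eq_bigr => m _; rewrite linearP.
Qed.

HB.instance Definition _ := bilinear_isBilinear.Build K
  (freeNA K T) (freeNA K T) (freeNA K T) *:%R *:%R free_mul free_mul_bilinear.

Lemma free_mulUU m n : free_mul << m >> << n >> = << FMul m n >>.
Proof. by rewrite /free_mul !mextendU. Qed.

Lemma free_ind (V : lmodType K) (phi psi : {linear freeNA K T -> V}) :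
  (forall m, phi << m >> = psi << m >>) -> phi =1 psi.
Proof.
move=> eq_m f; have Zm c m : << c *g m >> = c *: << m >> :> freeNA K T.
  by apply/malgP => k; rewrite mcoeffZ !mcoeffU mulr_natr.
rewrite [f]monalgE !linear_sum; apply: eq_bigr => m _ /=.
by rewrite Zm !linearZ /= eq_m.
Qed.

Fixpoint eval_monom (V : lmodType K) (mulV : V -> V -> V) (v : T -> V)
    (m : fmagma T) : V :=
  match m with
  | FGen t => v t
  | FMul m1 m2 => mulV (eval_monom mulV v m1) (eval_monom mulV v m2)
  end.

Lemma free_lift (V : lmodType K) (mulV : {bilinear V -> V -> V}) (v : T -> V) :
  exists2 phi : {linear freeNA K T -> V},
    alg_morph free_mul mulV phi & forall t, phi (free_gen t) = v t.
Proof.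
exists (mextend (eval_monom mulV v)); last by move=> t; exact: mextendU.
move=> f g; rewrite /= /free_mul {2}/mextend linear_sum {3}/mextend linear_sumlz.
apply: eq_bigr => m _; rewrite linearZ linearZl_LR /=; congr (_ *: _).
rewrite {2}/mextend linear_sum linear_sumr.
apply: eq_bigr => n _; rewrite linearZ linearZr /=.
by congr (_ *: _); exact: mextendU.
Qed.

Lemma free_lift_unique (V : lmodType K) (mulV : {bilinear V -> V -> V})
    (phi psi : {linear freeNA K T -> V}) :
    alg_morph free_mul mulV phi -> alg_morph free_mul mulV psi ->
  (forall t, phi (free_gen t) = psi (free_gen t)) -> phi =1 psi.
Proof.
move=> phiM psiM eq_t; apply: free_ind.
elim=> [t|m IHm n IHn]; first exact: eq_t.
by rewrite -free_mulUU phiM psiM IHm IHn.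
Qed.

End FreeAlgebra.

(* The degree-g variable named x is the generator (x, g). An evaluation is a
   homomorphism from the free algebra; by free_lift and free_lift_unique, it
   amounts to an arbitrary choice of the images of the generators. *)
Definition graded_identity (K : fieldType) (G : semigroupType) (X : choiceType)
    (A : gradedAlg K G) (f : freeNA K (X * G)%type) : Prop :=
  forall phi : {linear freeNA K (X * G)%type -> A},
    alg_morph (@free_mul K (X * G)%type) (ga_mul A) phi ->
    (forall (x : X) (g : G), phi (free_gen K (x, g)) \in ga_comp A g) ->
  phi f = 0.

(* Main.v *)
Require Import Defs.
From HB Require Import structures.
From mathcomp Require Import all_boot all_order all_algebra.
From mathcomp Require Import fingroup perm finmap monalg closed_field.
From mathcomp Require Import zify ring.
From Stdlib Require Import Classical.

Set Implicit Arguments.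
Unset Strict Implicit.
Unset Printing Implicit Defensive.

Import GRing.Theory.
Local Open Scope ring_scope.

(** Isomorphic algebras satisfy the same identities, because evaluations can be
transported along the isomorphism and back. The converse rests on three ideas.

Simplicity makes graded polynomials flexible. Fix a homogeneous basis [a] of
[A]. Consider the operators on [A] each of whose blocks [A_h -> A_g] has the
form [y |-> W(a; y)] for a graded polynomial [W] that is linear in [y]. They
form an algebra that contains the projections onto the components and the
multiplications by basis vectors, so a subspace invariant under it is a graded
ideal. Burnside's theorem then shows that every operator arises in this way; in
particular there are polynomials that act as matrix units ([matrix_units]).
Nesting them yields a polynomial [F(w; z_1, ..., z_n; y)] that is multilinear
and alternating in [z] on every graded algebra, and such that
[F(a; a; a_i0) = a_i0] for some index [i0] ([exists_alternating]).

Alternating polynomials carry information from one algebra to the other. If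
[F(w; z; y)] is nonzero then [z] is linearly independent. Since [F] is not an
identity of [A] it is not one of [B], and by symmetry [A] and [B] have
homogeneous bases with the same degrees ([hbasis_transfer]). If [x] is a
homogeneous basis, then replacing [x_k] by [x_i x_j] multiplies [F(w; x; y)] by
a structure constant of [x]. Hence, for every polynomial [p] in the structure
constants, some graded polynomial takes the value [p(x) F(w; x; -)^N (y)] at all
homogeneous bases [x] of all algebras ([scalar_poly_eval]). It follows that [p]
vanishes at all homogeneous bases of [A] if and only if it vanishes at those of
[B] ([vanishing_transfer]): the sets of structure constants of [A] and of [B],
which are orbits of one linear group, have the same Zariski closure.

Two such orbits meet. For given structure constants, the existence in [B] of
homogeneous elements, not all zero, that multiply accordingly is a first-order
condition. As [K] is algebraically closed, the condition is equivalent to one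
without quantifiers. It holds on the orbit of [B], which is irreducible because
two bases are joined by a line ([generic_common]); therefore it holds on the
common closure outside the zero set of a polynomial that does not vanish
identically on the orbits ([constructible_generic]), hence for some basis of
[A]. This gives a nonzero graded morphism from [A] to [B]. It is injective
because [A] is graded simple, and bijective because the dimensions agree
([iso_of_structure]). *)

(** * Subspaces given by predicates, and Burnside's theorem *)
Section Subspaces.
Variables (K : fieldType) (V : vectType K).

Definition linear_pred (U : lmodType K) (P : U -> Prop) : Prop :=
  P 0 /\ forall (a : K) u v, P u -> P v -> P (a *: u + v).

Lemma linear_pred_sum (U : lmodType K) (P : U -> Prop) (I : Type) (r : seq I)
    (Q : pred I) (k : I -> K) (u : I -> U) :
  linear_pred P -> (forall i, Q i -> P (u i)) ->
  P (\sum_(i <- r | Q i) k i *: u i).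
Proof.
move=> [P0 Plin] Pu; elim/big_rec: _ => // i x Qi Px.
by apply: Plin => //; apply: Pu.
Qed.

(** Invariant subspaces and sets of realized operators are described by
propositions; this turns them into subspaces with a dimension. A subspace of
maximal dimension among those contained in [P] is all of [P]. *)
Lemma linear_pred_vspace (P : V -> Prop) :
  linear_pred P -> exists U : {vspace V}, forall u, u \in U <-> P u.
Proof.
move=> [P0 Plin].
suff grow m (U : {vspace V}) : (\dim {:V} - \dim U <= m)%N ->
    (forall u, u \in U -> P u) ->
    exists W : {vspace V}, forall u, u \in W <-> P u.
  apply: (grow _ 0%VS (leqnn _)) => u; rewrite memv0 => /eqP->; exact: P0.
elim: m U => [|m IHm] U dimU subU.
  exists U => u; split; first exact: subU.
  suff ->: U = fullv by rewrite memvf.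
  by apply/eqP; rewrite eqEdim subvf -subn_eq0 -leqn0.
case: (classic (exists2 u, P u & u \notin U)) => [[u Pu Uu]|no_u]; last first.
  exists U => u; split=> [|Pu]; first exact: subU.
  by case Uu: (u \in U) => //; case: no_u; exists u; rewrite ?Uu.
apply: (IHm (U + <[u]>)%VS) => [|w /memv_addP[x Ux [y /vlineP[k ->] ->]]].
  have lt_dim: (\dim U < \dim (U + <[u]>))%N.
    rewrite ltnNge; apply/negP=> le_dim.
    have /eqP eqU: (U == U + <[u]>)%VS by rewrite eqEdim addvSl.
    by move/negP: Uu; apply; rewrite eqU memvE addvSr.
  by rewrite leq_subLR; move: dimU; rewrite leq_subLR; lia.
by rewrite addrC; apply: Plin => //; apply: subU.
Qed.

End Subspaces.

Section Burnside.
Variables (K : closedFieldType) (n : nat).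
Variable M : 'M[K]_n -> Prop.
Hypothesis M_lin : linear_pred M.
Hypothesis M_1 : M 1%:M.
Hypothesis M_mul : forall S T, M S -> M T -> M (S *m T).
Hypothesis M_irr : forall P : 'rV[K]_n -> Prop, linear_pred P ->
  (forall u T, P u -> M T -> P (u *m T)) ->
  (exists2 u, P u & u != 0) -> forall u, P u.

Lemma irr_transitive (u v : 'rV[K]_n) :
  u != 0 -> exists2 T, M T & u *m T = v.
Proof.
move=> nz_u; pose P x := exists2 T, M T & u *m T = x.
apply: (M_irr (P := P)); last by exists u => //; exists 1%:M; rewrite ?mulmx1.
  split=> [|a x y [S MS <-] [T MT <-]].
    by exists 0; [case: M_lin | rewrite mulmx0].
  by exists (a *: S + T); [apply: M_lin.2 | rewrite mulmxDr -scalemxAr].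
by move=> x T [S MS <-] MT; exists (S *m T); rewrite ?mulmxA //; apply: M_mul.
Qed.

Lemma exists_eigenvalue r (A : 'M[K]_r.+1) :
  exists a, (\rank (A - a%:M)%R < r.+1)%N.
Proof.
have /closed_rootP[a] : size (char_poly A) != 1%N by rewrite size_char_poly.
rewrite -eigenvalue_root_char /eigenvalue /eigenspace /= kermx_eq0 => nfree.
by exists a; rewrite ltn_neqAle rank_leq_row andbT.
Qed.

(** Let [T = C R] be a factorization of [T] in [M] through dimension [r] at
least 2. For [S] in [M] and an eigenvalue [a] of the [r] by [r] matrix [R S C],
the matrix [T S T - a T = C (R S C - a) R] has smaller rank than [T], and it is
nonzero if [R S C] is not scalar. Irreducibility supplies such an [S]. *)
Lemma irr_rank1 : (0 < n)%N ->
  exists T, M T /\ \rank T = 1%N.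
Proof.
move=> n_gt0.
suff drop m T : (\rank T <= m)%N -> M T -> T != 0 ->
    exists S, M S /\ \rank S = 1%N.
  apply: (drop n 1%:M) => //; first exact: rank_leq_row.
  by rewrite -mxrank_eq0 mxrank1 -lt0n.
elim: m T => [|m IHm] T rkT MT nzT.
  by move: nzT; rewrite -mxrank_eq0 -leqn0 rkT.
case def_r: (\rank T) => [|[|r]].
- by move: nzT; rewrite -mxrank_eq0 def_r.
- by exists T.
have [C [R [defT Cfull Rfree]]] : exists (C : 'M_(n, r.+2)) (R : 'M_(r.+2, n)),
    [/\ C *m R = T, row_full C & row_free R].
  rewrite -def_r; exists (col_base T), (row_base T).
  by rewrite mulmx_base col_base_full row_base_free.
have nz_row: row 0 R != 0.
  apply/eqP => R0; have := row_free_inj Rfree.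
  move=> /(_ 1%N (delta_mx 0 0) 0); rewrite -rowE R0 mul0mx.
  move=> /(_ erefl)/rowP/(_ 0).
  by rewrite !mxE eqxx => /eqP; rewrite oner_eq0.
(* With this [u], if [row 0 R *m S = u] then the first row of [R S C] is the
   second unit vector, so that [R S C] is not scalar. *)
pose u : 'rV_n := delta_mx 0 1 *m pinvmx C.
have uC: u *m C = delta_mx 0 1 by rewrite mulmxKpV // submx_full.
have [S MS defu] := irr_transitive u nz_row.
have [a rk_a] := exists_eigenvalue (R *m S *m C).
pose T' := C *m (R *m S *m C - a%:M) *m R.
have defT': T' = (- a) *: T + T *m S *m T.
  rewrite /T' mulmxBr mulmxBl mul_mx_scalar -scalemxAl defT scaleNr addrC.
  by congr (_ + _); rewrite -defT !mulmxA.
apply: (IHm T').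
- have: (\rank T' < r.+2)%N.
    by apply: leq_ltn_trans (mxrankM_maxl _ _) _;
      apply: leq_ltn_trans (mxrankM_maxr _ _) rk_a.
  by rewrite ltnS => /leq_trans-> //; rewrite -ltnS -def_r.
- by rewrite defT'; apply: M_lin.2 => //; do 2?apply: M_mul.
apply/eqP; rewrite /T' -[RHS](mul0mx _ R) => /(row_free_inj Rfree).
rewrite -[RHS](mulmx0 _ C) => /(row_full_inj Cfull)/(congr1 (row 0)).
rewrite linearB /= !row_mul defu uC => /rowP/(_ 1)/eqP.
by rewrite !mxE !eqxx /= mulr0n subr0 oner_eq0.
Qed.

(** From one element [v *m r] of rank one, irreducibility on rows gives all
[v *m u]. The columns then follow by duality: if the columns [x] such that [M]
contains all [x *m u] did not exhaust the space, then the rows that annihilate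
them would form a nonzero proper invariant subspace. *)
Lemma burnside (T : 'M[K]_n) : M T.
Proof.
have [n0|n_gt0] := posnP n.
  suff ->: T = 0 by case: M_lin.
  by apply/matrixP => i; have := leq_trans (ltn_ord i) (eq_leq n0).
have [T0 [MT0 rkT0]] := irr_rank1 n_gt0.
have [v [r [defT0 vfull rfree]]] : exists (v : 'cV_n) (r : 'rV_n),
    [/\ v *m r = T0, row_full v & row_free r].
  rewrite -rkT0; exists (col_base T0), (row_base T0).
  by rewrite mulmx_base col_base_full row_base_free.
have nz_r : r != 0 by rewrite -mxrank_eq0 (eqP rfree).
pose D (x : 'cV_n) := forall u, M (x *m u).
have Dlin : linear_pred D.
  split=> [u|a x y Dx Dy u]; first by rewrite mul0mx; case: M_lin.
  by rewrite mulmxDl -scalemxAl; apply: M_lin.2.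
have DT S x : M S -> D x -> D (S *m x).
  by move=> MS Dx u; rewrite -mulmxA; apply: M_mul.
have Dv : D v.
  move=> u; have [S MS <-] := irr_transitive u nz_r.
  by rewrite mulmxA defT0; apply: M_mul.
have [U UP] := linear_pred_vspace Dlin.
have Dall x : D x.
  apply/UP; case Ux: (x \in U) => //; exfalso.
  have: x - projv U x != 0.
    by apply: contraFneq Ux => /subr0_eq->; apply: memv_proj.
  case/matrix0Pn=> k [j]; rewrite [j]ord1 => nz_k.
  (* The row [y] represents a coordinate of [id - projv U], a map that kills
     [U] but not [x]. *)
  pose y := \row_l (delta_mx l 0 - projv U (delta_mx l 0) : 'cV_n) k 0.
  have yE z : (y *m z) 0 0 = (z - projv U z) k 0.
    rewrite mxE [in RHS](matrix_sum_delta z).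
    under [in RHS]eq_bigr do rewrite big_ord1.
    rewrite linear_sum -sumrB summxE; apply: eq_bigr => l _.
    by rewrite linearZ /= -scalerBr [RHS]mxE mxE mulrC.
  pose Y (y : 'rV_n) := forall z, D z -> (y *m z) 0 0 = 0.
  have Ylin : linear_pred Y.
    split=> [z _|a y1 y2 Y1 Y2 z Dz]; first by rewrite mul0mx mxE.
    by rewrite mulmxDl -scalemxAl mxE mxE Y1 // Y2 // mulr0 addr0.
  have Yv w : Y w.
    apply: M_irr => // [u S Yu MS z Dz|].
      by rewrite -mulmxA; apply/Yu/DT.
    exists y; first by move=> z /UP Uz; rewrite yE projv_id // subrr mxE.
    by apply: contraNneq nz_k => y0; rewrite -yE y0 mul0mx mxE.
  have [w wv] := row_fullP vfull.
  by have /eqP := Yv w v Dv; rewrite wv mxE oner_eq0.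
rewrite (matrix_sum_delta T) /=.
have Msum (I : finType) (F : I -> 'M_n) : (forall i, M (F i)) -> M (\sum_i F i).
  move=> MF; rewrite -(eq_bigr _ (fun i _ => scale1r (F i))).
  exact: linear_pred_sum.
apply: (Msum) => i; apply: (Msum) => j.
rewrite -[_ *: _]addr0; apply: M_lin.2; last by case: M_lin.
by rewrite -(mul_delta_mx (0 : 'I_1)); apply: Dall.
Qed.

End Burnside.

(** * Homogeneous components and homogeneous bases *)
Section DirectSums.
Variables (K : fieldType) (V : vectType K) (I : eqType).
Implicit Type W : I -> {vspace V}.

Lemma directv_seqP W (s : seq I) : uniq s ->
  reflect (forall u : I -> V, (forall h, h \in s -> u h \in W h) ->
             \sum_(h <- s) u h = 0 -> forall h, h \in s -> u h = 0)
          (directv (\sum_(h <- s) W h)).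
Proof.
move=> s_uniq; pose W' k := W (tnth (in_tuple s) k).
have ->: directv (\sum_(h <- s) W h) = directv (\sum_k W' k).
  by rewrite !directvE /= !(big_tnth _ _ s).
apply: (iffP directv_sum_independent) => [indep u Wu u0 h | indep u Wu u0 k _].
  case/(tnthP (in_tuple s))=> k ->.
  apply: (indep (fun k => u (tnth (in_tuple s) k))) => // [i _|].
    by apply: Wu; rewrite mem_tnth.
  by rewrite -[RHS]u0 (big_tnth _ _ s).
pose u' h := if insub (index h s) is Some k then u k else 0.
have u'E j : u' (tnth (in_tuple s) j) = u j.
  rewrite /u' (tnth_nth (tnth (in_tuple s) j)) index_uniq //.
  by rewrite valK.
rewrite -u'E; apply: indep; last exact: mem_tnth.
  by move=> _ /(tnthP (in_tuple s))[j ->]; rewrite u'E; apply: Wu.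
by rewrite (big_tnth _ _ s) -[RHS]u0; apply: eq_bigr => j _; rewrite u'E.
Qed.

Lemma directv_sub_seq W W' (s : seq I) : uniq s ->
  (forall h, (W' h <= W h)%VS) ->
  directv (\sum_(h <- s) W h) -> directv (\sum_(h <- s) W' h).
Proof.
move=> s_uniq sW /(directv_seqP _ s_uniq) indep; apply/directv_seqP => // u Wu.
by apply: indep => h /Wu; apply/subvP.
Qed.

End DirectSums.

Section HomogeneousFamilies.
Variables (K : fieldType) (G : semigroupType) (C : gradedAlg K G).

Definition homog (I : Type) (d : I -> G) (c : I -> C) : Prop :=
  forall i, c i \in ga_comp C (d i).

(** The independence of the components, for a family in which several members
may have the same degree. *)
Lemma homog_component (I : finType) (d : I -> G) (u : I -> C) (g h : G) :
    homog d u -> \sum_i u i \in ga_comp C g ->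
  \sum_(i | d i == h) u i = if h == g then \sum_i u i else 0.
Proof.
move=> hu Cv; set v := \sum_i u i in Cv *; pose s := undup [:: g, h & codom d].
have s_uniq : uniq s := undup_uniq _.
have [_ _ /(_ s s_uniq)/(directv_seqP _ s_uniq) indep] := ga_direct C.
have sd i : d i \in s by rewrite mem_undup !inE codom_f !orbT.
have [sg sh] : g \in s /\ h \in s by rewrite !mem_undup !inE !eqxx orbT.
have sum1 x (y : C) : x \in s -> \sum_(k <- s | k == x) y = y.
  by move=> sx; rewrite -big_filter filter_pred1_uniq // big_seq1.
apply/eqP; rewrite -subr_eq0; apply/eqP.
pose w k := \sum_(i | d i == k) u i - (if k == g then v else 0).
apply: (indep w) => // [k _|]; rewrite /w.
  apply: memvB; first by apply: memv_suml => i /eqP<-.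
  by case: eqP => [->|_]; rewrite ?mem0v.
rewrite sumrB (exchange_big_dep xpredT) //= -big_mkcond /= sum1 //.
by under eq_bigr => i _ do (under eq_bigl do rewrite eq_sym; rewrite sum1 //);
  rewrite subrr.
Qed.

Lemma homog_sum_eq0 (I : finType) (d : I -> G) (u : I -> C) (g : G) :
  homog d u -> \sum_i u i = 0 -> \sum_(i | d i == g) u i = 0.
Proof.
move=> hu u0; rewrite (homog_component (g := g) _ hu) u0 ?mem0v //.
by rewrite if_same.
Qed.

Variables (n : nat) (d : 'I_n -> G).

(** The degrees [d] are fixed in advance, so that bases of different algebras
can be substituted for the same graded variables. *)
Definition hbasis (c : 'I_n -> C) : Prop :=
  basis_of fullv (mktuple c) /\ homog d c.

Definition hcoord (c : 'I_n -> C) (i : 'I_n) (u : C) : K :=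
  coord (mktuple c) i u.

HB.instance Definition _ c i :=
  GRing.Linear.copy (hcoord c i) (coord (mktuple c) i).

Lemma hcoordK c u : hbasis c -> u = \sum_i hcoord c i u *: c i.
Proof.
case=> bc _; rewrite {1}(coord_basis bc (memvf u)).
by apply: eq_bigr => i _; rewrite (nth_map i) ?size_enum_ord // nth_ord_enum.
Qed.

Lemma hcoord_sum c i (k : 'I_n -> K) :
  hbasis c -> hcoord c i (\sum_j k j *: c j) = k i.
Proof.
case=> /basis_free fc _; rewrite -[RHS](coord_sum_free k i fc);
  congr (hcoord c i _).
by apply: eq_bigr => j _; rewrite (nth_map j) ?size_enum_ord // nth_ord_enum.
Qed.

Lemma hcoord_delta c i j : hbasis c -> hcoord c i (c j) = (i == j)%:R.
Proof.
move=> hc; rewrite -(hcoord_sum i (fun k => (k == j)%:R) hc);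
  congr (hcoord c i _).
by rewrite (bigD1 j) //= eqxx scale1r big1 ?addr0 // => k /negPf->;
  rewrite scale0r.
Qed.

Lemma hbasis_neq0 c i : hbasis c -> c i != 0.
Proof.
move=> hc; apply/eqP => ci0; have := hcoord_delta i i hc;
  rewrite ci0 linear0 eqxx.
by move/esym/eqP; rewrite oner_eq0.
Qed.

Lemma hbasisP (c : 'I_n -> C) : n = \dim {:C} -> homog d c ->
  (forall k : 'I_n -> K, \sum_i k i *: c i = 0 -> forall i, k i = 0) ->
  hbasis c.
Proof.
move=> dimC hc free_c; split=> //;
  rewrite basisEfree subvf size_tuple -dimC leqnn.
rewrite !andbT; apply/freeP => k k0; apply: free_c; rewrite -[RHS]k0.
by apply: eq_bigr => j _; rewrite (nth_map j) ?size_enum_ord // nth_ord_enum.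
Qed.

Lemma hbasis_dim c : hbasis c -> \dim {:C} = n.
Proof. by case=> /size_basis. Qed.

Lemma hbasis_hcoord0 c u g : hbasis c -> u \in ga_comp C g ->
  forall i, d i != g -> hcoord c i u = 0.
Proof.
move=> hc Cu i nz_i; pose k j := if d j == d i then hcoord c j u else 0.
have: \sum_j k j *: c j = 0.
  have hw : homog d (fun j => hcoord c j u *: c j).
    by move=> j; rewrite memvZ //; apply: hc.2.
  have := homog_component (g := g) (d i) hw; rewrite -hcoordK // (negPf nz_i).
  move=> /(_ Cu) comp0; rewrite -[RHS]comp0 [RHS]big_mkcond /=.
  by apply: eq_bigr => j _; rewrite /k; case: ifP; rewrite ?scale0r.
by move/(congr1 (hcoord c i)); rewrite hcoord_sum // linear0 /k eqxx.
Qed.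

Lemma hbasis_support c u g i :
  hbasis c -> u \in ga_comp C g -> hcoord c i u != 0 -> d i = g.
Proof.
by move=> hc Cu; apply: contra_neq_eq => /(hbasis_hcoord0 hc Cu).
Qed.

Lemma hbasis_mem_comp c u g : hbasis c ->
  (forall i, d i != g -> hcoord c i u = 0) -> u \in ga_comp C g.
Proof.
move=> hc u0; rewrite (hcoordK u hc); apply: memv_suml => i _.
have [<-|/u0->] := eqVneq (d i) g; last by rewrite scale0r mem0v.
by rewrite memvZ //; apply: hc.2.
Qed.

Definition component c (g : G) (u : C) : C :=
  \sum_(i | d i == g) hcoord c i u *: c i.

Lemma component_mem c g u : hbasis c -> component c g u \in ga_comp C g.
Proof.
by move=> hc; apply: memv_suml => i /eqP<-; rewrite memvZ //; apply: hc.2.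
Qed.

Lemma component_homog c g h u : hbasis c -> u \in ga_comp C g ->
  component c h u = if h == g then u else 0.
Proof.
move=> hc Cu; have hw : homog d (fun j => hcoord c j u *: c j).
  by move=> j; rewrite memvZ //; apply: hc.2.
by have := homog_component (g := g) h hw;
  rewrite -(hcoordK u hc) /component => ->.
Qed.

Lemma component_lin c g k u v :
  component c g (k *: u + v) = k *: component c g u + component c g v.
Proof.
rewrite /component scaler_sumr -big_split /=; apply: eq_bigr => i _.
by rewrite linearP scalerDl scalerA.
Qed.

Lemma component_sum c g (k : 'I_n -> K) (u : 'I_n -> C) :
  component c g (\sum_i k i *: u i) = \sum_i k i *: component c g (u i).
Proof.
have C0 : component c g 0 = 0.
  by rewrite /component big1 // => i _; rewrite linear0 scale0r.
elim/big_rec2: _ => [//|i x y _ <-]; exact: component_lin.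
Qed.

Lemma sum_component c u : hbasis c ->
  u = \sum_(g <- undup (codom d)) component c g u.
Proof.
move=> hc; rewrite {1}(hcoordK u hc) [RHS](exchange_big_dep xpredT) //=.
apply: eq_bigr => i _; under eq_bigl do rewrite eq_sym.
rewrite -big_filter filter_pred1_uniq ?undup_uniq ?mem_undup ?codom_f //.
by rewrite big_seq1.
Qed.

(** An ideal is graded as soon as it is stable under the projections onto the
components; the directness of the sum is inherited from the algebra. *)
Lemma graded_ideal_components c (I : {vspace C}) : hbasis c ->
  two_sided_ideal I -> (forall g u, u \in I -> component c g u \in I) ->
  graded_ideal I.
Proof.
move=> hc idI compI; split=> //; split=> [g|u Iu|s s_uniq]; first exact: capvSl.
  exists (undup (codom d)); rewrite (sum_component u hc).
  rewrite !(big_tnth _ _ (undup _)); apply: memv_sumr => k _.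
  by rewrite memv_cap compI // component_mem.
have [_ _ dirC] := ga_direct C.
by apply: directv_sub_seq (dirC s s_uniq) => // g; apply: capvSr.
Qed.

End HomogeneousFamilies.

Lemma hbasis_exists (K : fieldType) (G : semigroupType) (C : gradedAlg K G) :
  exists n (d : 'I_n -> G) (c : 'I_n -> C), hbasis d c.
Proof.
suff grow m (t : seq (C * G)) : (\dim {:C} - size t <= m)%N ->
    free (map fst t) -> (forall x, x \in t -> x.1 \in ga_comp C x.2) ->
    exists n (d : 'I_n -> G) (c : 'I_n -> C), hbasis d c.
  by apply: (grow _ [::] (leqnn _)); rewrite ?nil_free.
elim: m t => [|m IHm] t dim_t free_t ht.
  exists (size t), (fun i => (tnth (in_tuple t) i).2).
  exists (fun i => (tnth (in_tuple t) i).1).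
  split=> [|i]; last by apply: ht; apply: mem_tnth.
  rewrite basisEfree subvf size_tuple -subn_eq0 -leqn0 dim_t !andbT.
  suff <-: map fst t = mktuple (fun i => (tnth (in_tuple t) i).1) by [].
  by rewrite -[t in LHS]/(tval (in_tuple t)) -map_tnth_enum -map_comp.
case: (classic (exists2 x, x.1 \in ga_comp C x.2
                         & x.1 \notin <<map fst t>>%VS)).
  case=> x Cx t'x; apply: (IHm (x :: t)) => /=.
  - by rewrite subnS; lia.
  - by rewrite free_cons t'x.
  by move=> y; rewrite inE => /predU1P[->|/ht].
move=> no_x; apply: (IHm t) => //.
have full_t: fullv = <<map fst t>>%VS.
  apply/eqP; rewrite eqEsubv subvf andbT; apply/subvP=> u _.
  have [_ /(_ u (memvf u))[s us] _] := ga_direct C.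
  apply: subvP us; rewrite big_tnth; apply/subv_sumP => k _;
    apply/subvP => v Cv.
  by apply/negPn/negP => t'v; case: no_x; exists (v, tnth (in_tuple s) k).
rewrite full_t; move: free_t; rewrite /free => /eqP->.
by rewrite size_map subnn.
Qed.

(** * Graded polynomial functions *)
Section Evaluation.
Variables (K : fieldType) (T : choiceType).

Definition free_eval (V : lmodType K) (mulV : {bilinear V -> V -> V})
    (v : T -> V) : {linear freeNA K T -> V} := mextend (eval_monom mulV v).

Lemma free_eval_gen (V : lmodType K) (mulV : {bilinear V -> V -> V}) v t :
  free_eval mulV v (free_gen K t) = v t.
Proof. exact: mextendU. Qed.

Lemma free_eval_unique (V : lmodType K) (mulV : {bilinear V -> V -> V})
    (phi : {linear freeNA K T -> V}) v :
    alg_morph (@free_mul K T) mulV phi ->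
  (forall t, phi (free_gen K t) = v t) -> phi =1 free_eval mulV v.
Proof.
move=> phiM phi_v; apply: free_ind => m; rewrite [RHS]mextendU.
elim: m => [t|m1 IH1 m2 IH2] /=; first exact: phi_v.
by rewrite -free_mulUU phiM IH1 IH2.
Qed.

Lemma free_eval_morph (V : lmodType K) (mulV : {bilinear V -> V -> V}) v :
  alg_morph (@free_mul K T) mulV (free_eval mulV v).
Proof.
have [phi phiM phi_v] := free_lift mulV v.
by move=> f g; rewrite -!(free_eval_unique phiM phi_v).
Qed.

End Evaluation.

(** Substituting polynomials and then evaluating amounts to evaluating at the
values of those polynomials. *)
Lemma free_eval_comp (K : fieldType) (T T' : choiceType) (V : lmodType K)
    (mulV : {bilinear V -> V -> V}) (phi : {linear freeNA K T' -> V})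
    (s : T -> freeNA K T') (v : T -> V) f :
  alg_morph (@free_mul K T') mulV phi -> (forall t, phi (s t) = v t) ->
  phi (free_eval (@free_mul K T') s f) = free_eval mulV v f.
Proof.
move=> phiM phi_s.
apply: (free_eval_unique (phi := phi \o free_eval (@free_mul K T') s)).
  by move=> x y; rewrite /= free_eval_morph phiM.
by move=> t; rewrite /= free_eval_gen.
Qed.

Section PolynomialFunctions.
Variables (K : fieldType) (G : semigroupType) (n : nat) (d : 'I_n -> G).

Local Notation var := (option ('I_n + 'I_n)%type).

Definition var_deg (e : G) (t : var) : G :=
  match t with None => e | Some (inl i) | Some (inr i) => d i end.

Definition assign (C : Type) (w z : 'I_n -> C) (y : C) (t : var) : C :=
  match t with None => y | Some (inl i) => w i | Some (inr i) => z i end.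

(** Polynomials are handled through the functions that they induce on all
graded algebras at once. The variables come in three groups: [w] will be a
basis used as a source of coefficients, [z] the arguments in which polynomials
are multilinear, and [y] the argument of an operator. *)
Definition algfun : Type :=
  forall C : gradedAlg K G, ('I_n -> C) -> ('I_n -> C) -> C -> C.

(** [F] is induced by a polynomial, and takes values of degree [g] when [w] and
[z] have degrees [d] and [y] has degree [e]. The polynomial itself may contain
monomials of other degrees, as long as they cancel in every algebra; this
makes homogeneity a property of the values only. *)
Definition graded_poly (e g : G) (F : algfun) : Prop :=
  (exists f : freeNA K var, forall (C : gradedAlg K G) w z y,
     free_eval (ga_mul C) (assign w z y) f = F C w z y) /\
  (forall (C : gradedAlg K G) w z y, homog d w -> homog d z ->
     y \in ga_comp C e -> F C w z y \in ga_comp C g).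

Lemma graded_poly_w e i : graded_poly e (d i) (fun C w z y => w i).
Proof.
split=> [|C w z y hw hz Cy]; last exact: hw.
by exists (free_gen K (Some (inl i))) => *; rewrite free_eval_gen.
Qed.

Lemma graded_poly_z e i : graded_poly e (d i) (fun C w z y => z i).
Proof.
split=> [|C w z y hw hz Cy]; last exact: hz.
by exists (free_gen K (Some (inr i))) => *; rewrite free_eval_gen.
Qed.

Lemma graded_poly_y e : graded_poly e e (fun C w z y => y).
Proof. by split=> //; exists (free_gen K None) => *; rewrite free_eval_gen. Qed.

Lemma graded_poly_0 e g : graded_poly e g (fun C w z y => 0).
Proof.
split=> [|C w z y *]; last exact: mem0v.
by exists 0 => *; rewrite linear0.
Qed.

Lemma graded_poly_lin e g (a : K) F H :
  graded_poly e g F -> graded_poly e g H ->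
  graded_poly e g (fun C w z y => a *: F C w z y + H C w z y).
Proof.
move=> [[f fF] homF] [[h hH] homH]; split=> [|C w z y hw hz Cy].
  by exists (a *: f + h) => C w z y; rewrite linearP fF hH.
by rewrite memvD ?memvZ ?homF ?homH.
Qed.

Lemma graded_poly_scale e g (a : K) F : graded_poly e g F ->
  graded_poly e g (fun C w z y => a *: F C w z y).
Proof.
move=> [[f fF] homF]; split=> [|C w z y hw hz Cy]; last by rewrite memvZ ?homF.
by exists (a *: f) => C w z y; rewrite linearZ /= fF.
Qed.

Lemma graded_poly_mul e g h F H : graded_poly e g F -> graded_poly e h H ->
  graded_poly e (g * h)%g (fun C w z y => ga_mul C (F C w z y) (H C w z y)).
Proof.
move=> [[f fF] homF] [[k kH] homH]; split=> [|C w z y hw hz Cy].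
  by exists (free_mul f k) => C w z y; rewrite free_eval_morph fF kH.
by apply: ga_compM; [apply: homF | apply: homH].
Qed.

Lemma graded_poly_sum e g (I : finType) (P : pred I) (F : I -> algfun) :
  (forall i, P i -> graded_poly e g (F i)) ->
  graded_poly e g (fun C w z y => \sum_(i | P i) F i C w z y).
Proof.
move=> polyF; split=> [|C w z y hw hz Cy].
  have /fin_all_exists[f fF] : forall i, exists f : freeNA K var, P i ->
      forall (C : gradedAlg K G) w z y,
        free_eval (ga_mul C) (assign w z y) f = F i C w z y.
    move=> i; case Pi: (P i); last by exists 0.
    by have [[f fF] _] := polyF i Pi; exists f.
  exists (\sum_(i | P i) f i) => C w z y; rewrite linear_sum.
  by apply: eq_bigr => i Pi; apply: fF.
by apply: memv_suml => i /polyF[_]; apply.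
Qed.

Lemma graded_poly_subst e e' g (F Y : algfun) (Z : 'I_n -> algfun) :
  (forall i, graded_poly e' (d i) (Z i)) ->
  graded_poly e' e Y -> graded_poly e g F ->
  graded_poly e' g (fun C w z y => F C w (fun i => Z i C w z y) (Y C w z y)).
Proof.
move=> polyZ [[k kY] homY] [[f fF] homF]; split=> [|C w z y hw hz Cy];
  last first.
  by apply: homF => //; [move=> i; apply: (polyZ i).2 | apply: homY].
have /fin_all_exists[r rZ] : forall i, exists r : freeNA K var,
    forall (C : gradedAlg K G) w z y,
      free_eval (ga_mul C) (assign w z y) r = Z i C w z y.
  by move=> i; have [[r rZ] _] := polyZ i; exists r.
pose s := assign (fun i => free_gen K (Some (inl i))) r k.
exists (free_eval (@free_mul K var) s f).
move=> C w z y; rewrite -fF; apply: free_eval_comp;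
  first exact: free_eval_morph.
by move=> [[i|i]|] /=; rewrite ?free_eval_gen ?rZ ?kY.
Qed.

Lemma graded_poly_eq e g F (C : gradedAlg K G) w w' z z' y :
  graded_poly e g F -> w =1 w' -> z =1 z' -> F C w z y = F C w' z' y.
Proof.
move=> [[f fF] _] ww zz; rewrite -!fF; apply: free_eval_unique;
  first exact: free_eval_morph.
by move=> [[i|i]|] /=; rewrite free_eval_gen /= ?ww ?zz.
Qed.

(** The variables [w], [z], [y] are finitely many, so the polynomial can be
rewritten in the variables indexed by [X] and compared with identities. *)
Lemma graded_poly_identity (X : choiceType) (A B : gradedAlg K G) e g F :
    (exists i : nat -> X, bijective i) ->
    (forall f : freeNA K (X * G)%type,
       graded_identity B f -> graded_identity A f) ->
    graded_poly e g F ->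
    (forall w z y,
       homog d w -> homog d z -> y \in ga_comp B e -> F B w z y = 0) ->
  forall w z y, homog d w -> homog d z -> y \in ga_comp A e -> F A w z y = 0.
Proof.
case=> i [j ijK jiK] idBA [[f fF] _] B0 w z y hw hz Cy.
pose s (t : var) : freeNA K (X * G)%type :=
  free_gen K (i (choice.pickle t), var_deg e t).
have idB : graded_identity B (free_eval (@free_mul K _) s f).
  move=> phi phiM hphi; pose v t := phi (s t).
  pose vw k := v (Some (inl k)); pose vz k := v (Some (inr k)).
  rewrite (free_eval_comp (mulV := ga_mul B) (v := assign vw vz (v None))) //.
    by rewrite fF; apply: B0 => [k|k|]; apply: hphi.
  by move=> [[k|k]|].
pose v (xg : X * G) : A := if choice.unpickle (j xg.1) is Some t then
  if var_deg e t == xg.2 then assign w z y t else 0 else 0.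
have := idBA _ idB (free_eval (ga_mul A) v) (@free_eval_morph _ _ _ _ _).
rewrite (free_eval_comp (mulV := ga_mul A) (v := assign w z y)) ?fF;
  last 2 first.
- exact: free_eval_morph.
- by move=> t; rewrite free_eval_gen /v ijK choice.pickleK /= eqxx.
move=> idA; apply: idA => x h; rewrite free_eval_gen /v.
case: (choice.unpickle _) => [t|]; last exact: mem0v.
case: eqP => /= [<-|_]; last exact: mem0v.
by case: t => [[k|k]|] /=.
Qed.

End PolynomialFunctions.

(** * Polynomials acting as matrix units *)
Section MatrixUnits.
Variables (K : closedFieldType) (G : semigroupType) (n : nat) (d : 'I_n -> G).
Variables (A : gradedAlg K G) (a : 'I_n -> A).
Hypotheses (simpleA : graded_simple A) (ha : hbasis d a).

Definition algop : Type := forall C : gradedAlg K G, ('I_n -> C) -> C -> C.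

Definition graded_op (e g : G) (W : algop) : Prop :=
  graded_poly d e g (fun C w z y => W C w y) /\
  forall (C : gradedAlg K G) w k (y y' : C),
    W C w (k *: y + y') = k *: W C w y + W C w y'.

Lemma graded_op_sum e g W (C : gradedAlg K G) w (I : finType) (P : pred I)
    (k : I -> K) (u : I -> C) : graded_op e g W ->
  W C w (\sum_(i | P i) k i *: u i) = \sum_(i | P i) k i *: W C w (u i).
Proof.
case=> _ linW; have W0 : W C w 0 = 0.
  by have := linW C w (- 1) 0 0; rewrite scaler0 addr0 scaleN1r addNr.
elim/big_rec2: _ => [//|i x y _ <-]; exact: linW.
Qed.

Lemma graded_op_0 e g : graded_op e g (fun C w y => 0).
Proof.
by split=> [|C w k y y']; [apply: graded_poly_0 | rewrite scaler0 addr0].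
Qed.

Lemma graded_op_comp e h g W W' : graded_op h g W -> graded_op e h W' ->
  graded_op e g (fun C w y => W C w (W' C w y)).
Proof.
move=> [polyW linW] [polyW' linW']; split=> [|C w k y y']; last first.
  by rewrite linW' linW.
have := graded_poly_subst (graded_poly_z K d e) polyW' polyW; exact.
Qed.

Definition row_image (T : 'M[K]_n) (k : 'I_n) : A := \sum_l T k l *: a l.

(** A polynomial has a fixed degree, so an operator is realized block by block:
for all indices [i] and [j], its block from the component of degree [d j] to
that of degree [d i] is given by a polynomial. Matrices act on rows, and
[row_image T k] is the image of the basis vector [a k]. *)
Definition realized (T : 'M[K]_n) : Prop := forall i j, exists W,
  graded_op (d j) (d i) W /\
  forall k, d k = d j -> W A a (a k) = component d a (d i) (row_image T k).

Lemma realized_lin : linear_pred realized.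
Proof.
split=> [i j|k S T MS MT i j].
  exists (fun C w y => 0); split=> [|l _]; first exact: graded_op_0.
  rewrite /row_image big1 => [|m _]; last by rewrite mxE scale0r.
  by rewrite (component_homog _ ha (mem0v (ga_comp A (d i)))) if_same.
have [W [[polyW linW] WS]] := MS i j; have [W' [[polyW' linW'] WT]] := MT i j.
exists (fun C w y => k *: W C w y + W' C w y); split=> [|l dl].
  split=> [|C w m y y']; first exact: graded_poly_lin.
  rewrite linW linW' !scalerDr !scalerA mulrC -!addrA; congr (_ + _).
  by rewrite addrCA.
rewrite WS // WT // -component_lin; congr component.
rewrite scaler_sumr -big_split /=; apply: eq_bigr => m _.
by rewrite !mxE scalerDl scalerA.
Qed.

Definition action_mx (f : A -> A) : 'M[K]_n :=
  \matrix_(k, l) hcoord a l (f (a k)).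

Lemma row_image_action f k : row_image (action_mx f) k = f (a k).
Proof. by rewrite [RHS](hcoordK _ ha); apply: eq_bigr => l _; rewrite mxE. Qed.

Lemma realized_1 : realized 1%:M.
Proof.
have <- : action_mx id = 1%:M.
  by apply/matrixP => k l; rewrite !mxE (hcoord_delta _ _ ha) eq_sym.
move=> i j; exists (fun C w y => if d i == d j then y else 0).
split=> [|k dk]; last first.
  by rewrite row_image_action (component_homog _ ha (ha.2 k)) dk.
case: eqP => [->|_]; last exact: graded_op_0.
by split=> //; apply: graded_poly_y.
Qed.

(** A choice of one index for each degree. Blocks are indexed by basis vectors,
and several basis vectors may have the same degree; sums over components then
run over the chosen indices. *)
Definition degree_rep (l : 'I_n) : 'I_n := odflt l [pick m | d m == d l].

Lemma degree_repK l : d (degree_rep l) = d l.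
Proof. by rewrite /degree_rep; case: pickP => [m /eqP|]. Qed.

Lemma eq_degree_rep l m : d l = d m -> degree_rep l = degree_rep m.
Proof.
rewrite /degree_rep => dlm; rewrite (eq_pick (Q := fun k => d k == d m));
  last by move=> k; rewrite /= dlm.
by case: pickP => [//|/(_ m)]; rewrite eqxx.
Qed.

Lemma sum_degree_rep (V : nmodType) (F : 'I_n -> V) :
  \sum_(m | degree_rep m == m) \sum_(l | d l == d m) F l = \sum_l F l.
Proof.
rewrite [RHS](partition_big degree_rep (fun m => degree_rep m == m)) /=;
  last first.
  by move=> l _; apply/eqP/eq_degree_rep/degree_repK.
apply: eq_bigr => m /eqP rm; apply: eq_bigl => l.
by apply/eqP/eqP => [/eq_degree_rep->|<-]; rewrite ?degree_repK.
Qed.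

(** A block of a product is the sum, over the intermediate components, of the
compositions of blocks. *)
Lemma realized_mul S T : realized S -> realized T -> realized (S *m T).
Proof.
move=> MS MT i j.
have /fin_all_exists[W WP] := fun m => MS m j.
have /fin_all_exists[W' W'P] := fun m => MT i m.
exists (fun C w y => \sum_(m | degree_rep m == m) W' m C w (W m C w y)); split.
  have comp m := graded_op_comp (W'P m).1 (WP m).1.
  split=> [|C w k y y'].
    have := graded_poly_sum (P := fun m => degree_rep m == m)
      (F := fun m C w z y => W' m C w (W m C w y)) (fun m _ => (comp m).1).
    exact.
  by rewrite scaler_sumr -big_split /=; apply: eq_bigr => m _;
    rewrite (comp m).2.
move=> k dk; under eq_bigr => m _.
  rewrite (WP m).2 // /component (graded_op_sum _ _ _ _ (W'P m).1).
  under eq_bigr => l /eqP dl do rewrite (W'P m).2 //.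
  over.
rewrite (sum_degree_rep (fun l =>
  hcoord a l (row_image S k) *: component d a (d i) (row_image T l))).
under eq_bigr => l _ do rewrite (hcoord_sum _ _ ha).
rewrite -component_sum; congr component.
under eq_bigr => l _ do rewrite scaler_sumr.
rewrite exchange_big /=; apply: eq_bigr => q _; rewrite mxE scaler_suml.
by apply: eq_bigr => l _; rewrite scalerA.
Qed.

Lemma realized_action (f : A -> A) :
    (forall i j, exists W, graded_op (d j) (d i) W /\
       forall k, d k = d j -> W A a (a k) = component d a (d i) (f (a k))) ->
  realized (action_mx f).
Proof.
move=> fW i j; have [W [polyW WE]] := fW i j; exists W; split=> // k dk.
by rewrite row_image_action WE.
Qed.

Lemma realized_component g : realized (action_mx (component d a g)).
Proof.
apply: realized_action => i j.
exists (fun C w y => if (d j == g) && (d j == d i) then y else 0); split.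
  case E: (_ && _); last exact: graded_op_0.
  have /andP[_ /eqP->] := E.
  by split=> //; apply: graded_poly_y.
move=> k dk; rewrite (component_homog g ha (ha.2 k)) dk eq_sym.
case: eqP => _ /=; last first.
  by rewrite (component_homog _ ha (mem0v (ga_comp A (d i)))) if_same.
by rewrite (component_homog _ ha (ha.2 k)) dk eq_sym.
Qed.

Lemma realized_mull m : realized (action_mx (ga_mul A (a m))).
Proof.
apply: realized_action => i j.
exists (fun C w y => if (d m * d j)%g == d i then ga_mul C (w m) y else 0);
  split.
  case: eqP => [<-|_]; last exact: graded_op_0.
  split=> [|C w k y y']; last by rewrite linearPr.
  by apply: graded_poly_mul; [apply: graded_poly_w | apply: graded_poly_y].
move=> k dk; rewrite (component_homog _ ha (ga_compM (ha.2 m) (ha.2 k))) dk.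
by rewrite eq_sym.
Qed.

Lemma realized_mulr m : realized (action_mx (fun x => ga_mul A x (a m))).
Proof.
apply: realized_action => i j.
exists (fun C w y => if (d j * d m)%g == d i then ga_mul C y (w m) else 0);
  split.
  case: eqP => [<-|_]; last exact: graded_op_0.
  split=> [|C w k y y']; last by rewrite linearPl.
  by apply: graded_poly_mul; [apply: graded_poly_y | apply: graded_poly_w].
move=> k dk; rewrite (component_homog _ ha (ga_compM (ha.2 k) (ha.2 m))) dk.
by rewrite eq_sym.
Qed.

Definition coord_row (x : A) : 'rV[K]_n := \row_k hcoord a k x.

Lemma coord_row_lin k x y :
  coord_row (k *: x + y) = k *: coord_row x + coord_row y.
Proof. by apply/rowP => i; rewrite !mxE linearP. Qed.

Lemma coord_row_action (f : A -> A) x :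
  (forall k x y, f (k *: x + y) = k *: f x + f y) ->
  coord_row (f x) = coord_row x *m action_mx f.
Proof.
move=> flin.
pose fl : {linear A -> A} := HB.pack f (GRing.isLinear.Build _ _ _ _ f flin).
apply/rowP => l; rewrite !mxE -[f]/(fl : A -> A) {1}(hcoordK x ha) !linear_sum.
by apply: eq_bigr => k _; rewrite !linearZ /= !mxE.
Qed.

(** The elements whose coordinate rows lie in an invariant subspace form a
graded ideal. *)
Lemma realized_irr (P : 'rV[K]_n -> Prop) : linear_pred P ->
  (forall u T, P u -> realized T -> P (u *m T)) ->
  (exists2 u, P u & u != 0) -> forall u, P u.
Proof.
move=> Plin Pinv [u0 Pu0 nz_u0].
have Qlin : linear_pred (fun x : A => P (coord_row x)).
  split=> [|k x y Px Py]; last by rewrite coord_row_lin; apply: Plin.2.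
  have -> : coord_row 0 = 0 by apply/rowP => i; rewrite !mxE linear0.
  by case: Plin.
have [U UP] := linear_pred_vspace Qlin.
have vr (u : 'rV[K]_n) : coord_row (\sum_k u 0 k *: a k) = u.
  by apply/rowP => i; rewrite mxE (hcoord_sum _ _ ha).
have gidU : graded_ideal U.
  apply: (graded_ideal_components ha) => [x y /UP Px|g x /UP Px]; last first.
    apply/UP; rewrite coord_row_action; last by move=> *; apply: component_lin.
    exact: Pinv (realized_component g).
  rewrite (hcoordK y ha) linear_sumr linear_sumlz.
  split; apply: memv_suml => m _.
    rewrite linearZr /= memvZ //; apply/UP.
    rewrite (coord_row_action (f := fun x => ga_mul A x (a m)));
      last by move=> *; rewrite linearPl.
    exact: Pinv (realized_mulr m).
  rewrite linearZl_LR /= memvZ //; apply/UP.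
  rewrite coord_row_action; last by move=> *; rewrite linearPr.
  exact: Pinv (realized_mull m).
case: (simpleA.2 U gidU) => defU u.
  have: \sum_k u0 0 k *: a k \in U by apply/UP; rewrite vr.
  rewrite defU memv0 => /eqP x0; case/eqP: nz_u0.
  by rewrite -(vr u0) x0; apply/rowP => i; rewrite !mxE linear0.
by rewrite -(vr u); apply/UP; rewrite defU memvf.
Qed.

Lemma matrix_units : exists E : 'I_n -> 'I_n -> algop, forall i j,
  graded_op (d j) (d i) (E i j) /\
  forall y, y \in ga_comp A (d j) -> E i j A a y = hcoord a j y *: a i.
Proof.
suff /fin_all_exists[f fP] : forall ij : 'I_n * 'I_n, exists W,
    graded_op (d ij.2) (d ij.1) W /\
    forall y, y \in ga_comp A (d ij.2) -> W A a y = hcoord a ij.2 y *: a ij.1.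
  by exists (fun i j => f (i, j)) => i j; apply: (fP (i, j)).
move=> [i j] /=.
have [W [polyW WE]] := burnside realized_lin realized_1 realized_mul realized_irr
  (delta_mx j i) i j.
exists W; split=> // y Cy.
have yE := component_homog (d j) ha Cy; rewrite eqxx in yE.
rewrite -{1}yE (graded_op_sum _ _ _ _ polyW).
under eq_bigr => k /eqP dk.
  rewrite WE // [row_image _ _](_ : _ = (k == j)%:R *: a i); last first.
    rewrite /row_image (bigD1 i) //= big1 ?addr0 => [|l /negPf nl]; last first.
      by rewrite mxE nl andbF scale0r.
    by rewrite mxE eqxx andbT.
  over.
rewrite (bigD1 j) //= big1 ?addr0 => [|k /andP[_ /negPf->]]; last first.
  rewrite scale0r (component_homog _ ha (mem0v (ga_comp A (d i)))) if_same.
  exact: scaler0.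
by rewrite eqxx scale1r (component_homog _ ha (ha.2 i)) eqxx.
Qed.

End MatrixUnits.

(** * Alternating polynomials *)
Section AlternatingPolynomials.
Variables (K : fieldType) (G : semigroupType) (n : nat) (d : 'I_n -> G).

Definition update (C : Type) (z : 'I_n -> C) (k : 'I_n) (u : C) (i : 'I_n) :=
  if i == k then u else z i.

Definition multilinear (F : algfun K G n) : Prop :=
  forall (C : gradedAlg K G) w z k a (u v : C) y,
    F C w (update z k (a *: u + v)) y =
      a *: F C w (update z k u) y + F C w (update z k v) y.

Definition alternating (F : algfun K G n) : Prop :=
  forall (C : gradedAlg K G) w z k l (y : C),
    k != l -> d k = d l -> z k = z l -> F C w z y = 0.

Definition linear_last (F : algfun K G n) : Prop :=
  forall (C : gradedAlg K G) w z a (y y' : C),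
    F C w z (a *: y + y') = a *: F C w z y + F C w z y'.

Definition deg_preserving (s : 'S_n) : bool := [forall i, d (s i) == d i].

(** Variables of different degrees cannot be exchanged in a graded polynomial,
so only the permutations that preserve degrees are used. *)
Definition alternation (F : algfun K G n) : algfun K G n := fun C w z y =>
  \sum_(s : 'S_n | deg_preserving s) (-1) ^+ s *: F C w (fun i => z (s i)) y.

Section Alternation.
Variables (e g : G) (F : algfun K G n).
Hypothesis polyF : graded_poly d e g F.

Lemma graded_poly_alternation : graded_poly d e g (alternation F).
Proof.
pose Fs (s : 'S_n) : algfun K G n := fun C w z y =>
  (-1) ^+ s *: @F C w (fun i => z (s i)) y.
apply: (graded_poly_sum (P := deg_preserving) (F := Fs)) => s /forallP ds.
apply: graded_poly_scale.
have polyZ i : graded_poly d e (d i) (fun (C : gradedAlg K G) w z y => z (s i)).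
  by rewrite -(eqP (ds i)); apply: graded_poly_z.
by have := graded_poly_subst polyZ (graded_poly_y K d e) polyF; apply.
Qed.

Lemma alternation_multilinear : multilinear F -> multilinear (alternation F).
Proof.
move=> linF C w z k a u v y.
have updE (s : 'S_n) x :
    @F C w (fun i => update z k x (s i)) y =
      @F C w (update (fun i => z (s i)) ((s^-1)%g k) x) y.
  apply: (graded_poly_eq _ polyF) => // i.
  by rewrite /update -(inj_eq (@perm_inj _ s) i) permKV.
rewrite /alternation scaler_sumr -big_split /=; apply: eq_bigr => s _.
by rewrite !updE linF scalerDr !scalerA mulrC.
Qed.

(** Even and odd permutations are paired by the transposition of [k] and [l];
comparing the alternation with its own opposite would not suffice in
characteristic 2. *)
Lemma alternation_alternating : alternating (alternation F).
Proof.
move=> C w z k l y nkl dkl zkl; pose t := tperm k l.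
have deg_t (s : 'S_n) : deg_preserving (s * t)%g = deg_preserving s.
  apply: eq_forallb => i; rewrite permM; congr (_ == _).
  by rewrite /t; case: tpermP => [->|->|].
have z_t i : z (t i) = z i by rewrite /t; case: tpermP => [->|->|].
rewrite /alternation (bigID (@odd_perm _)) /=.
rewrite [X in X + _](reindex_inj (mulIg t)) /= -[X in _ + X]opprK.
apply/eqP; rewrite subr_eq0 -sumrN; apply/eqP; apply: eq_big => [s|s _].
  by rewrite deg_t odd_permM odd_tperm nkl addbT.
rewrite -scaleNr odd_permM odd_tperm nkl addbT signrN; congr (_ *: _).
by apply: (graded_poly_eq _ polyF) => // i; rewrite permM z_t.
Qed.

Lemma alternation_linear_last : linear_last F -> linear_last (alternation F).
Proof.
move=> linF C w z a y y'; rewrite /alternation scaler_sumr -big_split /=.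
by apply: eq_bigr => s _; rewrite linF scalerDr !scalerA mulrC.
Qed.

End Alternation.

Lemma multilinear_sum F (C : gradedAlg K G) w z k (I : finType) (P : pred I)
    (a : I -> K) (u : I -> C) y : multilinear F ->
  F C w (update z k (\sum_(i | P i) a i *: u i)) y =
    \sum_(i | P i) a i *: F C w (update z k (u i)) y.
Proof.
move=> linF; have F0 : F C w (update z k 0) y = 0.
  by have := linF C w z k (- 1) 0 0 y; rewrite scaler0 addr0 scaleN1r addNr.
elim/big_rec2: _ => [//|i x v _ <-]; exact: linF.
Qed.

Section Substitution.
Variables (e g : G) (F : algfun K G n).
Hypotheses (polyF : graded_poly d e g F).
Hypotheses (linF : multilinear F) (altF : alternating F).
Variables (C : gradedAlg K G) (w : 'I_n -> C) (y : C).

(** For [l] different from [k], the term in which [z l] takes the place of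
[z k] has two equal arguments of the same degree. *)
Lemma alternating_subst z k (a : 'I_n -> K) :
  @F C w (update z k (\sum_(l | d l == d k) a l *: z l)) y = a k *: @F C w z y.
Proof.
rewrite multilinear_sum // (bigD1 k) //= big1 ?addr0 => [|l /andP[/eqP dl nlk]].
  congr (_ *: _); apply: (graded_poly_eq _ polyF) => // i.
  by rewrite /update; case: eqP => [->|].
rewrite (altF _ _ (k := k) (l := l)) ?scaler0 //; first by rewrite eq_sym.
by rewrite /update eqxx (negPf nlk).
Qed.

(** The part of degree [d k] of a linear relation is again a relation, and
substituting it for [z k] multiplies the value by [a k]. *)
Lemma alternating_free z (a : 'I_n -> K) : homog d z -> @F C w z y != 0 ->
  \sum_l a l *: z l = 0 -> forall k, a k = 0.
Proof.
move=> hz nzF az0 k; apply/eqP; apply: contraNT nzF => nz_a.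
have hw : homog d (fun l => a l *: z l) by move=> l; rewrite memvZ.
have := alternating_subst z k a; rewrite (homog_sum_eq0 (d k) hw az0).
have := linF w z k (- 1) 0 0 y; rewrite scaler0 addr0 scaleN1r addNr => ->.
by move/esym/eqP; rewrite scaler_eq0 (negPf nz_a).
Qed.

End Substitution.

End AlternatingPolynomials.

Section ExistsAlternating.
Variables (K : closedFieldType) (G : semigroupType) (n : nat) (d : 'I_n -> G).
Variables (A : gradedAlg K G) (a : 'I_n -> A).
Hypotheses (simpleA : graded_simple A) (ha : hbasis d a).

(** Since [A A] is nonzero, some [a_p a_q] has a nonzero coordinate [kappa] at
some [a_r]. Matrix units send [u] to a multiple of [a_p], [y] to a multiple of
[a_q], and the product back to the line of [a_i0], where [i0 = p]; the result
is a bilinear polynomial that multiplies [y] by a coordinate of [u]. *)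
Lemma exists_scaling : exists i0 (M : forall C : gradedAlg K G,
    'I_n -> ('I_n -> C) -> C -> C -> C),
  [/\ forall i, graded_poly d (d i0) (d i0) (fun C w z y => M C i w (z i) y),
      forall (C : gradedAlg K G) i w k (u u' : C) y,
        M C i w (k *: u + u') y = k *: M C i w u y + M C i w u' y,
      forall (C : gradedAlg K G) i w k (u y y' : C),
        M C i w u (k *: y + y') = k *: M C i w u y + M C i w u y'
    & forall i u y, u \in ga_comp A (d i) -> y \in ga_comp A (d i0) ->
        M A i a u y = (hcoord a i u * hcoord a i0 y) *: a i0].
Proof.
have [E EP] := matrix_units simpleA ha.
have [p [q nz_pq]] : exists p q, ga_mul A (a p) (a q) != 0.
  case: simpleA => -[x [y nz_xy]] _; apply: NNPP => no_pq; case/eqP: nz_xy.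
  rewrite (hcoordK x ha) (hcoordK y ha) linear_sumlz big1 // => p _.
  rewrite linear_sumr big1 // => q _; rewrite linearZl_LR linearZr /=.
  have [->|nz] := eqVneq (ga_mul A (a p) (a q)) 0; first by rewrite !scaler0.
  by case: no_pq; exists p, q.
have [r nz_r] : exists r, hcoord a r (ga_mul A (a p) (a q)) != 0.
  apply: NNPP => no_r; case/eqP: nz_pq;
    rewrite (hcoordK (ga_mul A _ _) ha) big1 // => r _.
  have [->|nz] := eqVneq (hcoord a r (ga_mul A (a p) (a q))) 0;
    first exact: scale0r.
  by case: no_r; exists r.
set kappa := hcoord a r _ in nz_r.
have Cpq := ga_compM (ha.2 p) (ha.2 q).
have dr : d r = (d p * d q)%g := hbasis_support ha Cpq nz_r.
exists p, (fun C i w u y =>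
  kappa^-1 *: E p r C w (ga_mul C (E p i C w u) (E q p C w y))).
split=> [i|C i w k u u' y|C i w k u y y'|i u y Cu Cy].
- apply: graded_poly_scale.
  have polyU : graded_poly d (d p) (d p) (fun C w z y => E p i C w (z i)).
    have polyZ := graded_poly_z K d (d p).
    have := graded_poly_subst polyZ (polyZ i) (EP p i).1.1; exact.
  have := graded_poly_mul polyU (EP q p).1.1; rewrite -dr => polyUV.
  have := graded_poly_subst (graded_poly_z K d (d p)) polyUV (EP p r).1.1;
    exact.
- rewrite (EP p i).1.2 linearPl (EP p r).1.2.
  by rewrite scalerDr !scalerA mulrC.
- rewrite (EP q p).1.2 linearPr (EP p r).1.2.
  by rewrite scalerDr !scalerA mulrC.
rewrite (EP p i).2 // (EP q p).2 // linearZl_LR linearZr /= scalerA.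
have := (EP p r).1.2 A a (hcoord a i u * hcoord a p y) (ga_mul A (a p) (a q)) 0.
have E0 : E p r A a 0 = 0.
  by have := (EP p r).2 0 (mem0v _); rewrite linear0 scale0r.
rewrite !addr0 E0 addr0 => ->; rewrite (EP p r).2 ?dr // -/kappa.
by rewrite !scalerA mulrC mulrA mulfV ?mul1r.
Qed.

(** Nesting the previous polynomials over all indices gives a multilinear
polynomial that, with [w] the basis [a], multiplies [a_i0] by the product of
the coordinates of [z_i] at [a_i]. Of its alternation at [z = a], only the
term of the identity permutation is nonzero. *)
Lemma exists_alternating : exists i0 F,
  [/\ graded_poly d (d i0) (d i0) F, multilinear F, alternating d F,
      linear_last F & F A a a (a i0) = a i0].
Proof.
have [i0 [M [polyM linU linY MA]]] := exists_scaling; exists i0.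
pose F s : algfun K G n := fun C w z y => foldr (fun i => M C i w (z i)) y s.
have polyF s : graded_poly d (d i0) (d i0) (F s).
  elim: s => [|i s IHs]; first exact: graded_poly_y.
  by have := graded_poly_subst (graded_poly_z K d (d i0)) IHs (polyM i); apply.
have linF s : linear_last (F s).
  elim: s => [//|i s IHs] C w z k y y' /=.
  by rewrite -linY -IHs.
have Fout s (C : gradedAlg K G) w z k (u : C) y : k \notin s ->
    F s C w (update z k u) y = F s C w z y.
  elim: s => [//|i s IHs]; rewrite inE negb_or => /andP[ki /IHs /= eqF].
  by rewrite /= /F /= -/(F s C w _ y) eqF /update eq_sym (negPf ki).
have mlinF s k : uniq s -> k \in s ->
    forall (C : gradedAlg K G) w z c (u v : C) y,
    F s C w (update z k (c *: u + v)) y =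
      c *: F s C w (update z k u) y + F s C w (update z k v) y.
  elim: s => [//|i s IHs] /andP[s'i s_uniq]; rewrite inE => k_is C w z c u v y.
  rewrite /F /= -![foldr _ _ _]/(F s C w _ y).
  have [eki|nki] := eqVneq k i; last first.
    rewrite (IHs s_uniq) ?linY; last by move: k_is; rewrite (negPf nki).
    by rewrite /update eq_sym (negPf nki).
  by rewrite !Fout ?eki // /update eqxx linU.
pose F0 := F (enum 'I_n); exists (alternation d F0).
have scalF s z : homog d z ->
    F s A a z (a i0) = (\prod_(i <- s) hcoord a i (z i)) *: a i0.
  move=> hz; elim: s => [|i s IHs]; first by rewrite big_nil scale1r.
  rewrite /F /= -/(F s A a z _) IHs MA ?memvZ ?ha.2 //.
  by rewrite linearZ /= (hcoord_delta _ _ ha) eqxx mulr1 big_cons.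
split.
- exact: graded_poly_alternation (polyF _).
- apply: (alternation_multilinear (polyF _)) => C w z k.
  by apply: mlinF; rewrite ?enum_uniq ?mem_enum.
- exact: alternation_alternating (polyF _).
- exact: alternation_linear_last (linF _).
rewrite /alternation {}/F0 (bigD1 1%g) /=; last first.
  by apply/forallP => i; rewrite perm1.
rewrite odd_perm1 scale1r big1 ?addr0 => [|s /andP[/forallP ds nt_s]].
  rewrite scalF // => [|i]; last by rewrite perm1; apply: ha.2.
  rewrite big1 => [|i _]; last by rewrite perm1 (hcoord_delta _ _ ha) eqxx.
  by rewrite scale1r.
have [i nsi] : exists i, s i != i.
  apply/existsP; apply: contraNT nt_s; rewrite negb_exists => /forallP s1.
  by apply/eqP/permP => i; rewrite perm1; apply/eqP/negPn/s1.
rewrite scalF // => [|k]; last by rewrite -(eqP (ds k)); apply: ha.2.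
rewrite (bigD1_seq i) ?mem_enum ?enum_uniq //=.
by rewrite (hcoord_delta _ _ ha) eq_sym (negPf nsi) mul0r scale0r scaler0.
Qed.

End ExistsAlternating.

(** * Polynomials in the structure constants *)
Section StructureConstants.
Variables (K : fieldType) (G : semigroupType) (n : nat) (d : 'I_n -> G).

Definition struct_const (C : gradedAlg K G) (x : 'I_n -> C)
    (t : 'I_n * 'I_n * 'I_n) : K :=
  hcoord x t.2 (ga_mul C (x t.1.1) (x t.1.2)).

(** The structure constants as the values of the variables of a formula. *)
Definition struct_consts (C : gradedAlg K G) (x : 'I_n -> C) : seq K :=
  codom (struct_const x).

Lemma nth_struct_consts (C : gradedAlg K G) (x : 'I_n -> C) t :
  (struct_consts x)`_(enum_rank t) = struct_const x t.
Proof. by rewrite nth_codom enum_rankK. Qed.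

Lemma eq_struct_consts (C : gradedAlg K G) (x y : 'I_n -> C) :
  x =1 y -> struct_consts x = struct_consts y.
Proof.
move=> xy; apply: eq_codom => t; rewrite /struct_const !xy /hcoord; congr coord.
by apply/val_inj/eq_map.
Qed.

Lemma nth_struct_constsP v :
  (forall (C : gradedAlg K G) (x : 'I_n -> C), (struct_consts x)`_v = 0) \/
  exists t, forall (C : gradedAlg K G) (x : 'I_n -> C),
    (struct_consts x)`_v = struct_const x t.
Proof.
have [lt_v|le_v] := ltnP v #|{: 'I_n * 'I_n * 'I_n}|.
  right; exists (enum_val (Ordinal lt_v)) => C x.
  by rewrite -nth_struct_consts enum_valK.
by left=> C x; rewrite nth_default // size_codom.
Qed.

Lemma eval_rterm_closed (X : Type) (e : X -> seq K) (S : (X -> K) -> Prop) :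
    (forall f g, f =1 g -> S f -> S g) ->
    (forall k, S (fun=> k)) ->
    (forall f g, S f -> S g -> S (fun x => f x + g x)) ->
    (forall f g, S f -> S g -> S (fun x => f x * g x)) ->
    (forall v, S (fun x => (e x)`_v)) ->
  forall t, GRing.rterm t -> S (fun x => GRing.eval (e x) t).
Proof.
move=> Sext Sk Sadd Smul Sv; elim=> //=.
- by move=> t1 IH1 t2 IH2 /andP[/IH1 S1 /IH2 S2]; apply: Sadd.
- move=> t IHt /IHt St; apply: (Sext (fun x => -1 * GRing.eval (e x) t)).
    by move=> x; rewrite mulN1r.
  exact: Smul.
- move=> t IHt k /IHt St; apply: (Sext (fun x => k%:R * GRing.eval (e x) t)).
    by move=> x; rewrite mulr_natl.
  exact: Smul.
- by move=> t1 IH1 t2 IH2 /andP[/IH1 S1 /IH2 S2]; apply: Smul.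
move=> t IHt k /IHt St; elim: k => [|k IHk]; first exact: (Sext (fun=> 1)).
apply: (Sext (fun x => GRing.eval (e x) t * GRing.eval (e x) t ^+ k)).
  by move=> x; rewrite exprS.
exact: Smul.
Qed.

Definition algebra_family : Type := {C : gradedAlg K G & 'I_n -> C}.

Variables (i0 : 'I_n) (F : algfun K G n).
Hypotheses (polyF : graded_poly d (d i0) (d i0) F) (mlinF : multilinear F).
Hypotheses (altF : alternating d F) (linF : linear_last F).

Lemma iter_linear_last N (C : gradedAlg K G) w z k (y y' : C) :
  iter N (@F C w z) (k *: y + y') =
    k *: iter N (@F C w z) y + iter N (@F C w z) y'.
Proof. by elim: N => //= N ->; rewrite linF. Qed.

Lemma iter_scale N (C : gradedAlg K G) w z k (y : C) :
  iter N (@F C w z) (k *: y) = k *: iter N (@F C w z) y.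
Proof.
have F0 : iter N (@F C w z) 0 = 0.
  have := iter_linear_last N w z (- 1) (0 : C) 0.
  by rewrite scaler0 addr0 scaleN1r addNr.
by have := iter_linear_last N w z k y 0; rewrite F0 !addr0.
Qed.

(** The scalar function [f] is realized by a graded polynomial up to the [N]-th
power of the operator [F(w; x; -)]: multiplication by a nonconstant function of
[x] need not be a polynomial operation by itself. The factor does no harm, since
at the basis [w = x = a] from which [F] was built it fixes [a_i0]. *)
Definition scalar_poly (N : nat) (f : algebra_family -> K) : Prop :=
  exists2 H : algfun K G n, graded_poly d (d i0) (d i0) H &
    forall (C : gradedAlg K G) w x y, hbasis d x ->
      H C w x y = f (existT _ C x) *: iter N (@F C w x) y.

Lemma scalar_poly_const k : scalar_poly 0 (fun=> k).
Proof.
exists (fun C w z y => k *: y) => //.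
exact: graded_poly_scale (graded_poly_y _ _ _).
Qed.

Lemma scalar_poly_add N f g : scalar_poly N f -> scalar_poly N g ->
  scalar_poly N (fun x => f x + g x).
Proof.
move=> [H polyH HE] [L polyL LE].
exists (fun C w z y => 1 *: H C w z y + L C w z y) => [|C w x y hx].
  exact: graded_poly_lin.
by rewrite HE // LE // scale1r scalerDl.
Qed.

Lemma scalar_poly_mul N M f g : scalar_poly N f -> scalar_poly M g ->
  scalar_poly (N + M) (fun x => f x * g x).
Proof.
move=> [H polyH HE] [L polyL LE].
exists (fun C w z y => H C w z (L C w z y)) => [|C w x y hx].
  by have := graded_poly_subst (graded_poly_z K d (d i0)) polyL polyH; apply.
by rewrite HE // LE // iter_scale scalerA iterD.
Qed.

(** This raises the exponent, so that functions realized with different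
exponents can be added. *)
Lemma scalar_poly_1 N : scalar_poly N (fun=> 1).
Proof.
elim: N => [|N [H polyH HE]]; first exact: scalar_poly_const.
exists (fun C w z y => F w z (H C w z y)) => [|C w x y hx].
  by have := graded_poly_subst (graded_poly_z K d (d i0)) polyH polyF; apply.
by rewrite HE // !scale1r.
Qed.

(** Replacing [x_k] by [x_i x_j] in an alternating polynomial extracts the
coordinate of [x_i x_j] at [x_k]. The substitution is legitimate only if the
degrees agree; otherwise the structure constant is zero. *)
Lemma scalar_poly_struct_const t :
  scalar_poly 1 (fun x => struct_const (projT2 x) t).
Proof.
case: t => -[i j] k; rewrite /struct_const /=.
have [dk|ndk] := eqVneq (d k) (d i * d j)%g; last first.
  exists (fun C w z y => 0) => [|C w x y hx]; first exact: graded_poly_0.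
  rewrite (hbasis_hcoord0 hx (ga_compM (hx.2 i) (hx.2 j))) ?scale0r //.
exists (fun C w z y => F w (update z k (ga_mul C (z i) (z j))) y) =>
  [|C w x y hx].
  pose Z l : algfun K G n := fun C w z y => update z k (ga_mul C (z i) (z j)) l.
  have polyZ l : graded_poly d (d i0) (d l) (Z l).
    rewrite /Z /update; case: eqP => [->|_]; last exact: graded_poly_z.
    by rewrite dk; apply: graded_poly_mul; apply: graded_poly_z.
  by have := graded_poly_subst polyZ (graded_poly_y K d (d i0)) polyF; apply.
have Cij := ga_compM (hx.2 i) (hx.2 j).
have := alternating_subst polyF mlinF altF w y x k (fun l =>
  hcoord x l (ga_mul C (x i) (x j))).
have := component_homog (d k) hx Cij; rewrite /component dk eqxx => ->.
exact.
Qed.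

Lemma scalar_poly_eval p : GRing.rterm p ->
  exists N, scalar_poly N (fun x => GRing.eval (struct_consts (projT2 x)) p).
Proof.
move: p; apply: (eval_rterm_closed (e := fun x : algebra_family =>
  struct_consts (projT2 x))
  (S := fun f => exists N, scalar_poly N f)).
- move=> f g fg [N [H polyH HE]]; exists N, H => // C w x y hx.
  by rewrite HE // fg.
- by move=> k; exists 0%N; apply: scalar_poly_const.
- move=> f g [N Sf] [M Sg]; exists (N + M)%N.
  have Sf1 := scalar_poly_mul Sf (scalar_poly_1 M).
  have := scalar_poly_add Sf1 (scalar_poly_mul (scalar_poly_1 N) Sg).
  by case=> H polyH HE; exists H => // C w x y hx; rewrite HE // mulr1 mul1r.
- by move=> f g [N Sf] [M Sg]; exists (N + M)%N; apply: scalar_poly_mul.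
move=> v; case: (nth_struct_constsP v) => [v0|[t vt]].
  exists 0%N; have [H polyH HE] := scalar_poly_const 0;
    exists H => // C w x y hx.
  by rewrite HE // v0.
exists 1%N; have [H polyH HE] := scalar_poly_struct_const t;
  exists H => // C w x y hx.
by rewrite HE // vt.
Qed.

End StructureConstants.

Section Transfer.
Variables (K : closedFieldType) (G : semigroupType) (X : choiceType).
Variables (n : nat) (d : 'I_n -> G) (A B : gradedAlg K G) (a : 'I_n -> A).
Hypotheses (X_countable : exists e : nat -> X, bijective e).
Hypotheses (simpleA : graded_simple A) (ha : hbasis d a).
Hypothesis idBA :
  forall f : freeNA K (X * G)%type, graded_identity B f -> graded_identity A f.

Lemma free_homog_exists : exists2 b : 'I_n -> B, homog d b &
  forall k : 'I_n -> K, \sum_i k i *: b i = 0 -> forall i, k i = 0.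
Proof.
have [i0 [F [polyF mlinF altF linF Fa]]] := exists_alternating simpleA ha.
apply: NNPP => no_b; case/eqP: (hbasis_neq0 i0 ha); rewrite -Fa.
apply: (graded_poly_identity X_countable idBA polyF) => [w z y hw hz Cy|||];
  last 3 first.
- exact: ha.2.
- exact: ha.2.
- exact: ha.2.
apply/eqP/negPn/negP => nz; case: no_b; exists z => // k.
exact: (alternating_free polyF mlinF altF (y := y) hz nz).
Qed.

Hypothesis dimB : \dim {:B} = n.

(** If [p] vanishes at the bases of [B], the polynomial that realizes [p],
composed once more with [F], is an identity of [B]: the outer [F] takes care of
the tuples that are not bases. Evaluating it in [A] at [w = x = a] leaves
[p(a) a_i0]. *)
Lemma vanishing_transfer p : GRing.rterm p ->
    (forall x : 'I_n -> B, hbasis d x -> GRing.eval (struct_consts x) p = 0) ->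
  GRing.eval (struct_consts a) p = 0.
Proof.
move=> rp p0.
have [i0 [F [polyF mlinF altF linF Fa]]] := exists_alternating simpleA ha.
have [N [H polyH HE]] := scalar_poly_eval polyF mlinF altF linF rp.
have polyL : graded_poly d (d i0) (d i0) (fun C w z y => F C w z (H C w z y)).
  by have := graded_poly_subst (graded_poly_z K d (d i0)) polyH polyF; apply.
have F0 (C : gradedAlg K G) (w x : 'I_n -> C) : F C w x 0 = 0.
  by have := iter_scale linF 1 w x 0 (0 : C); rewrite /= !scale0r.
have L0 (w z : 'I_n -> B) y : homog d w -> homog d z ->
    y \in ga_comp B (d i0) -> F B w z (H B w z y) = 0.
  move=> hw hz Cy; apply/eqP/negPn/negP => nz.
  have hbz : hbasis d z.
    by apply: hbasisP => // k; apply: (alternating_free polyF mlinF altF hz nz).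
  by case/eqP: nz; rewrite HE //= p0 // scale0r F0.
have := graded_poly_identity X_countable idBA polyL L0 ha.2 ha.2 (ha.2 i0).
rewrite HE //= -[F A a a _]/(iter 1 (F A a a) _) (iter_scale linF) /= -iterS.
have -> : iter N.+1 (F A a a) (a i0) = a i0 by apply: iter_fix.
by move/eqP; rewrite scaler_eq0 (negPf (hbasis_neq0 i0 ha)) orbF => /eqP.
Qed.

End Transfer.

Lemma free_leq_dim (K : fieldType) (V : vectType K) n (v : 'I_n -> V) :
  (forall k : 'I_n -> K, \sum_i k i *: v i = 0 -> forall i, k i = 0) ->
  (n <= \dim {:V})%N.
Proof.
move=> vfree; have free_v : free (mktuple v).
  apply/freeP => k k0; apply: vfree; rewrite -[RHS]k0.
  by apply: eq_bigr => j _; rewrite (nth_map j) ?size_enum_ord // nth_ord_enum.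
by move: free_v; rewrite /free size_tuple => /eqP <-; apply/dimvS/subvf.
Qed.

(** The alternating polynomial of [A] has a nonzero value in [B] at linearly
independent elements with degrees [d]; exchanging [A] and [B] shows that they
span. *)
Lemma hbasis_transfer (K : closedFieldType) (G : semigroupType) (X : choiceType)
    (n : nat) (d : 'I_n -> G) (A B : gradedAlg K G) (a : 'I_n -> A) :
    (exists e : nat -> X, bijective e) -> graded_simple A -> graded_simple B ->
    (forall f : freeNA K (X * G)%type,
       graded_identity A f <-> graded_identity B f) ->
    hbasis d a ->
  \dim {:B} = n /\ exists b : 'I_n -> B, hbasis d b.
Proof.
move=> X_countable simpleA simpleB idAB ha.
have [m [e [c hc]]] := hbasis_exists B.
have [b hb b_free] :=
  free_homog_exists X_countable simpleA ha (fun f => (idAB f).2).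
have [a' _ a'_free] :=
  free_homog_exists X_countable simpleB hc (fun f => (idAB f).1).
have dimB : \dim {:B} = n.
  apply/eqP; rewrite eqn_leq (free_leq_dim b_free) andbT.
  by rewrite (hbasis_dim hc) -(hbasis_dim ha) (free_leq_dim a'_free).
by split=> //; exists b; apply: hbasisP.
Qed.

(** * Irreducibility of the set of structure constants *)
Section Irreducibility.
Variables (K : closedFieldType) (G : semigroupType) (n : nat) (d : 'I_n -> G).
Variables (B : gradedAlg K G) (x1 x2 : 'I_n -> B).
Hypotheses (hx1 : hbasis d x1) (hx2 : hbasis d x2).

Definition line (t : K) (i : 'I_n) : B := x1 i + t *: (x2 i - x1 i).

Definition affine_coord (u v : B) (l : 'I_n) : {poly K} :=
  (hcoord x1 l u)%:P + 'X * (hcoord x1 l v)%:P.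

(** The coordinates of the points of the line in the basis [x1], as polynomials
in the parameter; the points at which the determinant vanishes are those that
are not bases. *)
Definition line_mx : 'M[{poly K}]_n :=
  \matrix_(i, l) affine_coord (x1 i) (x2 i - x1 i) l.

Definition line_mx_at (t : K) : 'M[K]_n := map_mx (horner_eval t) line_mx.

Lemma line_mx_atE t i l : line_mx_at t i l = hcoord x1 l (line t i).
Proof.
rewrite !mxE /horner_eval /affine_coord hornerD hornerM hornerX !hornerC.
by rewrite [in RHS]linearD linearZ.
Qed.

Lemma det_line t : (\det line_mx).[t] = \det (line_mx_at t).
Proof. by rewrite -[LHS]/(horner_eval t _) -det_map_mx. Qed.

Lemma line_hbasis t : (\det line_mx).[t] != 0 -> hbasis d (line t).
Proof.
rewrite det_line => nz_det; apply: hbasisP.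
- by rewrite (hbasis_dim hx1).
- by move=> i; rewrite memvD ?memvZ ?memvB ?hx1.2 ?hx2.2.
move=> k k0 i; pose r : 'rV_n := \row_j k j.
have r0 : r *m line_mx_at t = 0.
  apply/rowP => l; rewrite !mxE -[RHS](linear0 (hcoord x1 l)) -k0 linear_sum.
  by apply: eq_bigr => j _; rewrite line_mx_atE linearZ /= mxE.
have at_unit : line_mx_at t \in unitmx by rewrite unitmxE unitfE.
have /rowP/(_ i) : r = 0 by rewrite -(mulmxK at_unit r) r0 mul0mx.
by rewrite !mxE.
Qed.

Definition line_product (i j : 'I_n) : 'rV[{poly K}]_n :=
  \row_l (affine_coord (ga_mul B (x1 i) (x1 j))
            (ga_mul B (x2 i - x1 i) (x1 j) + ga_mul B (x1 i) (x2 j - x1 j)) l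
          + 'X^2 * (hcoord x1 l (ga_mul B (x2 i - x1 i) (x2 j - x1 j)))%:P).

Lemma line_productE t i j :
  map_mx (horner_eval t) (line_product i j) =
    \row_l hcoord x1 l (ga_mul B (line t i) (line t j)).
Proof.
apply/rowP => l; rewrite !mxE /horner_eval /affine_coord !hornerE /line.
rewrite ![x1 _ + _]addrC linearPl !linearPr scalerDr scalerA.
rewrite !linearD !linearZ /= addrA -!addrA; ring.
Qed.

Lemma cramer_line t k u : hbasis d (line t) ->
  (\det line_mx).[t] * hcoord (line t) k u =
    (\row_l hcoord x1 l u *m \adj (line_mx_at t)) 0 k.
Proof.
move=> ht.
have -> : \row_l hcoord x1 l u = \row_j hcoord (line t) j u *m line_mx_at t.
  apply/rowP => l; rewrite !mxE {1}(hcoordK u ht) linear_sum.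
  by apply: eq_bigr => j _; rewrite linearZ /= mxE line_mx_atE.
by rewrite -mulmxA mul_mx_adj mul_mx_scalar !mxE det_line.
Qed.

(** A rational function of the parameter whose denominator is a power of the
determinant. *)
Definition line_rational (f : K -> K) : Prop := exists N (P : {poly K}),
  forall t, (\det line_mx).[t] != 0 -> P.[t] = (\det line_mx).[t] ^+ N * f t.

Lemma line_rational_struct_const s :
  line_rational (fun t => struct_const (line t) s).
Proof.
case: s => -[i j] k; exists 1%N, ((line_product i j *m \adj line_mx) 0 k) =>
  t nz.
rewrite expr1 /struct_const /= cramer_line; last exact: line_hbasis.
rewrite -line_productE -map_mx_adj -map_mxM.
by rewrite [RHS]mxE.
Qed.

Lemma line_rational_eval p : GRing.rterm p ->
  line_rational (fun t => GRing.eval (struct_consts (line t)) p).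
Proof.
move: p; apply: (eval_rterm_closed (e := fun t =>
  struct_consts (line t)) (S := line_rational)).
- by move=> f g fg [N [P PE]]; exists N, P => t nz; rewrite PE // fg.
- by move=> k; exists 0%N, k%:P => t nz; rewrite hornerC expr0 mul1r.
- move=> f g [N [P PE]] [M [Q QE]]; exists (N + M)%N.
  exists ((\det line_mx) ^+ M * P + (\det line_mx) ^+ N * Q) => t nz.
  by rewrite hornerD !hornerM !horner_exp PE // QE // exprD; ring.
- move=> f g [N [P PE]] [M [Q QE]]; exists (N + M)%N, (P * Q) => t nz.
  by rewrite hornerM PE // QE // exprD; ring.
move=> v; case: (nth_struct_constsP K G n v) => [v0|[s vs]].
  by exists 0%N, 0 => t nz; rewrite horner0 v0 mulr0.
have [N [P PE]] := line_rational_struct_const s.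
by exists N, P => t nz; rewrite PE // vs.
Qed.

Lemma line0 : line 0 =1 x1.
Proof. by move=> i; rewrite /line scale0r addr0. Qed.

Lemma line1 : line 1 =1 x2.
Proof. by move=> i; rewrite /line scale1r addrC subrK. Qed.

Lemma det_line_neq0 t x : line t =1 x -> hbasis d x -> (\det line_mx).[t] != 0.
Proof.
move=> tx hx; rewrite det_line -unitfE -unitmxE.
pose Y : 'M_n := \matrix_(i, l) hcoord x l (x1 i).
suff /mulmx1_unit[] : Y *m line_mx_at t = 1%:M by [].
apply/matrixP => i l; rewrite !mxE -[in RHS]eq_sym -(hcoord_delta l i hx1).
rewrite [in RHS](hcoordK (x1 i) hx) linear_sum; apply: eq_bigr => j _.
by rewrite linearZ /= line_mx_atE tx mxE.
Qed.

(** On the line from [x1] to [x2], both functions are rational and not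
identically zero, the first at parameter 0 and the second at parameter 1. A
nonzero polynomial over an algebraically closed field has a non-root. *)
Lemma generic_common p1 p2 : GRing.rterm p1 -> GRing.rterm p2 ->
    GRing.eval (struct_consts x1) p1 != 0 ->
    GRing.eval (struct_consts x2) p2 != 0 ->
  exists2 x : 'I_n -> B, hbasis d x &
    GRing.eval (struct_consts x) p1 != 0 /\
    GRing.eval (struct_consts x) p2 != 0.
Proof.
move=> /line_rational_eval[N1 [P1 P1E]] /line_rational_eval[N2 [P2 P2E]].
move=> nz1 nz2.
have nz_det0 : (\det line_mx).[0] != 0 := det_line_neq0 line0 hx1.
have nz_det1 : (\det line_mx).[1] != 0 := det_line_neq0 line1 hx2.
have nzP1 : P1 != 0.
  apply: contraNneq nz1 => P10; have /eqP := P1E 0 nz_det0.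
  rewrite P10 horner0 eq_sym mulf_eq0 expf_eq0 (negPf nz_det0) andbF.
  by rewrite (eq_struct_consts line0).
have nzP2 : P2 != 0.
  apply: contraNneq nz2 => P20; have /eqP := P2E 1 nz_det1.
  rewrite P20 horner0 eq_sym mulf_eq0 expf_eq0 (negPf nz_det1) andbF.
  by rewrite (eq_struct_consts line1).
have nz_det : \det line_mx != 0.
  by apply: contraNneq nz_det0 => ->; rewrite horner0.
have /closed_nonrootP[t] : \det line_mx * (P1 * P2) != 0 by rewrite !mulf_neq0.
rewrite !rootM !negb_or => /and3P[nz_t nzP1t nzP2t].
exists (line t); first exact: line_hbasis.
split.
  by apply: contraNneq nzP1t => e0; rewrite /root P1E // e0 mulr0.
by apply: contraNneq nzP2t => e0; rewrite /root P2E // e0 mulr0.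
Qed.

End Irreducibility.

(** * First-order conditions on irreducible sets *)
Section Genericity.
Variable K : fieldType.
Variables P Q : seq K -> Prop.
Hypothesis P_nonempty : exists e, P e.
Hypothesis P_irr : forall p1 p2, GRing.rterm p1 -> GRing.rterm p2 ->
  (exists2 e, P e & GRing.eval e p1 != 0) ->
  (exists2 e, P e & GRing.eval e p2 != 0) ->
  exists2 e, P e & GRing.eval e p1 != 0 /\ GRing.eval e p2 != 0.
Hypothesis PQ : forall p, GRing.rterm p ->
  (forall e, P e -> GRing.eval e p = 0) -> forall e, Q e -> GRing.eval e p = 0.

(** The formula [f] has the truth value [v] on a nonempty open part of [P], and
on the corresponding part of [Q]. *)
Definition eventually (f : GRing.formula K) (v : bool) : Prop :=
  exists p : GRing.term K,
  [/\ GRing.rterm p, exists2 e, P e & GRing.eval e p != 0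
    & forall e, P e \/ Q e -> GRing.eval e p != 0 -> GRing.qf_eval e f = v].

Lemma eventually_and f1 f2 v1 v2 f v : eventually f1 v1 -> eventually f2 v2 ->
  (forall e, GRing.qf_eval e f1 = v1 -> GRing.qf_eval e f2 = v2 ->
     GRing.qf_eval e f = v) ->
  eventually f v.
Proof.
move=> [p1 [r1 nz1 E1]] [p2 [r2 nz2 E2]] fE; exists (p1 * p2)%T.
split=> [|| e Pe /=]; first by rewrite /= r1.
  by have [e Pe [nz1e nz2e]] := P_irr r1 r2 nz1 nz2; exists e;
    rewrite //= mulf_neq0.
by rewrite mulf_eq0 negb_or => /andP[/(E1 e Pe) E1e /(E2 e Pe) E2e]; apply: fE.
Qed.

(** An equation either holds throughout [P], and then throughout [Q], or it
fails wherever the difference of its sides does not vanish. Irreducibility of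
[P] allows the open parts for two subformulas to be intersected. *)
Lemma qf_generic f : GRing.qf_form f -> GRing.rformula f ->
  exists v, eventually f v.
Proof.
elim: f => //=.
- move=> v _ _; exists v, (GRing.Const 1); split=> //.
  by have [e Pe] := P_nonempty; exists e; rewrite //= oner_neq0.
- move=> t u _ /andP[rt ru]; pose p := (t - u)%T.
  case: (classic (exists2 e, P e & GRing.eval e p != 0)) => [nzp|zp].
    exists false, p; split=> //=; first by rewrite rt.
    by move=> e _ /=; rewrite subr_eq0 => /negPf.
  exists true, (GRing.Const 1); split=> //.
    by have [e Pe] := P_nonempty; exists e; rewrite //= oner_neq0.
  have Pp e : P e -> GRing.eval e p = 0.
    by move=> Pe; apply/eqP/negPn/negP => nz; case: zp; exists e.
  move=> e PQe _ /=; rewrite -subr_eq0; apply/eqP.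
  by case: PQe => [/Pp|]; last by apply: PQ Pp _; rewrite /= rt.
- move=> f1 IH1 f2 IH2 /andP[q1 q2] /andP[r1 r2].
  have [v1 E1] := IH1 q1 r1; have [v2 E2] := IH2 q2 r2.
  by exists (v1 && v2); apply: eventually_and E1 E2 _ => e /= -> ->.
- move=> f1 IH1 f2 IH2 /andP[q1 q2] /andP[r1 r2].
  have [v1 E1] := IH1 q1 r1; have [v2 E2] := IH2 q2 r2.
  by exists (v1 || v2); apply: eventually_and E1 E2 _ => e /= -> ->.
- move=> f1 IH1 f2 IH2 /andP[q1 q2] /andP[r1 r2].
  have [v1 E1] := IH1 q1 r1; have [v2 E2] := IH2 q2 r2.
  by exists (v1 ==> v2); apply: eventually_and E1 E2 _ => e /= -> ->.
move=> f1 IH1 q1 r1; have [v1 [p [rp nzp pE]]] := IH1 q1 r1.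
by exists (~~ v1), p; split=> // e Pe nz /=; rewrite pE.
Qed.

End Genericity.

(** Quantifier elimination makes the condition [f] quantifier-free. As it holds
on [P], its generic truth value is true, and the open part on which it takes
that value meets [Q] because [Q] has the same vanishing polynomials. *)
Lemma constructible_generic (K : closedFieldType) (P Q : seq K -> Prop)
    (f : GRing.formula K) :
    (exists e, P e) ->
    (forall p1 p2, GRing.rterm p1 -> GRing.rterm p2 ->
      (exists2 e, P e & GRing.eval e p1 != 0) ->
      (exists2 e, P e & GRing.eval e p2 != 0) ->
      exists2 e, P e & GRing.eval e p1 != 0 /\ GRing.eval e p2 != 0) ->
    (forall p, GRing.rterm p ->
      (forall e, P e -> GRing.eval e p = 0) <->
      (forall e, Q e -> GRing.eval e p = 0)) ->
    (forall e, P e -> GRing.holds e f) ->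
  exists2 e, Q e & GRing.holds e f.
Proof.
move=> P_nonempty P_irr PQ Pf.
pose qe := GRing.quantifier_elim (@ClosedFieldQE.ex_elim K) (GRing.to_rform f).
have wf := @ClosedFieldQE.wf_ex_elim K.
have ok := ClosedFieldQE.holds_ex_elim (@solve_monicpoly K).
have rf := GRing.to_rform_rformula f.
have qeP e : reflect (GRing.holds e f) (GRing.qf_eval e qe).
  by apply: (iffP (GRing.quantifier_elim_rformP wf ok e rf)) => /GRing.to_rformP.
have /andP[qf_qe r_qe] := GRing.quantifier_elim_wf wf rf.
have [v [p [rp nzp pE]]] :=
  qf_generic P_nonempty P_irr (fun p rp => (PQ p rp).1) qf_qe r_qe.
have vT : v = true.
  by have [e Pe nz] := nzp; rewrite -(pE e _ nz); [apply/qeP/Pf | left].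
have [e Qe nz] : exists2 e, Q e & GRing.eval e p != 0.
  apply: NNPP => zp; have [e0 Pe0 /eqP[]] := nzp;
    apply: (PQ p rp).2 Pe0 => e Qe.
  by apply/eqP/negPn/negP => nz; case: zp; exists e.
by exists e => //; apply/qeP; rewrite (pE e _ nz) //; right.
Qed.

(** * The existence of a nonzero morphism as a formula *)
Section MorphismFormula.
Variables (K : fieldType) (G : semigroupType) (n : nat) (d : 'I_n -> G).
Variables (B : gradedAlg K G) (b : 'I_n -> B).
Hypothesis hb : hbasis d b.

Definition all_formula (I : finType) (F : I -> GRing.formula K) :=
  foldr (fun i f => GRing.And (F i) f) (GRing.Bool true) (enum I).

Lemma holds_all e (I : finType) (F : I -> GRing.formula K) :
  GRing.holds e (all_formula F) <-> forall i, GRing.holds e (F i).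
Proof.
suff {}main s :
    GRing.holds e (foldr (fun i f => GRing.And (F i) f) (GRing.Bool true) s)
    <-> forall i, i \in s -> GRing.holds e (F i).
  by rewrite main; split=> Fe i *; apply: Fe; rewrite ?mem_enum.
elim: s => [|j s IHs] //=; rewrite IHs; split=> [[Fj Fs] i|Fe].
  by rewrite inE => /predU1P[->|/Fs].
by split=> [|i si]; apply: Fe; rewrite inE ?eqxx ?si ?orbT.
Qed.

Definition sum_term (I : finType) (F : I -> GRing.term K) : GRing.term K :=
  foldr (fun i t => GRing.Add (F i) t) (GRing.Const 0) (enum I).

Lemma eval_sum e (I : finType) (F : I -> GRing.term K) :
  GRing.eval e (sum_term F) = \sum_i GRing.eval e (F i).
Proof.
rewrite -big_enum /sum_term; elim: (enum I) => [|i s IHs];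
  first by rewrite big_nil.
by rewrite big_cons /= IHs.
Qed.

Local Notation T3 := ('I_n * 'I_n * 'I_n)%type.
Local Notation T2 := ('I_n * 'I_n)%type.

(** The variables after the structure constants stand for the coordinates, in
the basis [b], of the images of the basis vectors under the desired morphism.
The coordinates at basis vectors of the wrong degree are set to zero. *)
Definition candidate_var (i q : 'I_n) : nat := (#|{: T3}| + enum_rank (i, q))%N.

Definition candidate_coord (i q : 'I_n) : GRing.term K :=
  if d q == d i then GRing.Var K (candidate_var i q) else GRing.Const 0.

(** For [t = (i, j, q)]: the coordinate at [b q] of the requirement that the
product of the images of the basis vectors [i] and [j] be the image of their
product. *)
Definition mul_eq (t : T3) : GRing.formula K := GRing.Equal
  (sum_term (fun l : T2 => GRing.Mul
     (GRing.Mul (candidate_coord t.1.1 l.1) (candidate_coord t.1.2 l.2))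
     (GRing.Const (struct_const b (l.1, l.2, t.2)))))
  (sum_term (fun k : 'I_n => GRing.Mul
     (GRing.Var K (enum_rank (t.1.1, t.1.2, k))) (candidate_coord k t.2))).

Definition nonzero_morphism_body : GRing.formula K :=
  GRing.And (all_formula mul_eq) (GRing.Not (all_formula (fun l : T2 =>
     GRing.Equal (candidate_coord l.1 l.2) (GRing.Const 0)))).

(** For an algebra whose homogeneous basis has the structure constants given by
the free variables, this says that some nonzero graded morphism to [B] exists.
For a graded simple algebra such a morphism is injective, so that asking for it
spares a determinant in the formula. *)
Definition nonzero_morphism : GRing.formula K :=
  foldr GRing.Exists nonzero_morphism_body (iota #|{: T3}| #|{: T2}|).

Definition candidate (e : seq K) (i : 'I_n) : B :=
  \sum_q GRing.eval e (candidate_coord i q) *: b q.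

Lemma hcoord_candidate e i q :
  hcoord b q (candidate e i) = GRing.eval e (candidate_coord i q).
Proof.
exact: (hcoord_sum q (fun q => GRing.eval e (candidate_coord i q)) hb).
Qed.

Lemma candidate_homog e : homog d (candidate e).
Proof.
move=> i; apply: (hbasis_mem_comp hb) => q /negPf ndq.
by rewrite hcoord_candidate /candidate_coord ndq.
Qed.

Lemma eq_hcoord (u v : B) : (forall q, hcoord b q u = hcoord b q v) -> u = v.
Proof.
move=> uv; rewrite (hcoordK u hb) (hcoordK v hb).
by apply: eq_bigr => q _; rewrite uv.
Qed.

Definition structure_image (e : seq K) (y : 'I_n -> B) : Prop :=
  (forall i j, ga_mul B (y i) (y j) = \sum_k e`_(enum_rank (i, j, k)) *: y k) /\
  exists i, y i != 0.

Lemma holds_body e : GRing.holds e nonzero_morphism_body <->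
  structure_image e (candidate e).
Proof.
have mulE i j q : hcoord b q (ga_mul B (candidate e i) (candidate e j)) =
    \sum_(l : T2) GRing.eval e (candidate_coord i l.1) *
      GRing.eval e (candidate_coord j l.2) * struct_const b (l.1, l.2, q).
  rewrite /candidate linear_sumlz linear_sum -(pair_bigA _ (fun l m =>
    GRing.eval e (candidate_coord i l) * GRing.eval e (candidate_coord j m) *
      struct_const b (l, m, q))).
  apply: eq_bigr => l _; rewrite linear_sumr linear_sum; apply: eq_bigr => m _.
  by rewrite linearZl_LR linearZr /= scalerA linearZ.
rewrite /= !holds_all; split=> [[mul_e nz]|[mul_e [i nz]]].
  split=> [i j|].
    apply: eq_hcoord => q; rewrite mulE linear_sum.
    have := mul_e (i, j, q); rewrite /= !eval_sum /= => ->.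
    by apply: eq_bigr => k _; rewrite linearZ /= hcoord_candidate.
  apply: NNPP => no_i; case: nz => -[i q] /=; rewrite -hcoord_candidate.
  have [->|nz] := eqVneq (candidate e i) 0; first exact: linear0.
  by case: no_i; exists i.
split=> [[[i' j] q]|zero].
  rewrite /= !eval_sum /= -mulE mul_e linear_sum.
  by apply: eq_bigr => k _; rewrite linearZ /= hcoord_candidate.
case/eqP: nz; apply: eq_hcoord => q; rewrite hcoord_candidate linear0.
exact: (zero (i, q)).
Qed.

Lemma holds_nonzero_morphism e : GRing.holds e nonzero_morphism ->
  exists2 y, homog d y & structure_image e y.
Proof.
case/GRing.foldExistsP=> e' eq_e /holds_body[mul_e nz].
exists (candidate e'); first exact: candidate_homog.
split=> // i j; rewrite mul_e; apply: eq_bigr => k _; rewrite -eq_e //.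
by rewrite !inE mem_iota negb_and -ltnNge ltn_ord.
Qed.

Lemma struct_consts_nonzero_morphism x (i0 : 'I_n) : hbasis d x ->
  @GRing.holds K (@struct_consts K G n B x) nonzero_morphism.
Proof.
move=> hx; pose e' := struct_consts x ++ codom (fun l : T2 =>
  hcoord b l.2 (x l.1)).
apply/GRing.foldExistsP; exists e' => [v|].
  rewrite !inE mem_iota negb_and -ltnNge -leqNgt nth_cat size_codom =>
    /orP[->|] //.
  case: ltnP => // le_v.
  rewrite (nth_default _ (s := struct_consts x)) ?size_codom // => le_v2.
  by rewrite nth_default // size_codom leq_subRL.
have candidateE : candidate e' =1 x.
  move=> i; apply: eq_hcoord => q; rewrite hcoord_candidate /candidate_coord.
  case: eqP => [_|/eqP nd] /=; last by rewrite (hbasis_hcoord0 hb (hx.2 i) nd).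
  rewrite nth_cat size_codom /candidate_var ltnNge leq_addr /= addKn.
  by rewrite nth_codom enum_rankK.
apply/holds_body; split=> [i j|]; last first.
  by exists i0; rewrite candidateE; apply: hbasis_neq0 hx.
rewrite !candidateE {1}(hcoordK (ga_mul B (x i) (x j)) hx);
  apply: eq_bigr => k _.
by rewrite candidateE nth_cat size_codom ltn_ord nth_struct_consts.
Qed.

End MorphismFormula.

(** * Isomorphisms and identities *)
Section Isomorphisms.
Variables (K : fieldType) (G : semigroupType).
Implicit Types A B : gradedAlg K G.

(** The elements [y] are the images of the basis vectors. The kernel is a
graded ideal, and it is not the whole algebra because some [y i] is nonzero. *)
Lemma iso_of_structure n (d : 'I_n -> G) A B (a : 'I_n -> A) (y : 'I_n -> B) :
    graded_simple A -> hbasis d a -> \dim {:B} = n -> homog d y ->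
    structure_image (struct_consts a) y ->
  graded_iso A B.
Proof.
move=> simpleA ha dimB hy [mul_y [i0 nz_y]].
pose f x := \sum_i hcoord a i x *: y i.
have f_lin : linear f.
  move=> k u v; rewrite scaler_sumr -big_split /=; apply: eq_bigr => i _.
  by rewrite linearP scalerDl scalerA.
pose phi : {linear A -> B} := HB.pack f (GRing.isLinear.Build _ _ _ _ f f_lin).
have phi_a i : phi (a i) = y i.
  rewrite /= /f (bigD1 i) //= (hcoord_delta _ _ ha) eqxx scale1r.
  rewrite big1 ?addr0 // => j nji.
  by rewrite (hcoord_delta _ _ ha) (negPf nji) scale0r.
have phiM : alg_morph (ga_mul A) (ga_mul B) phi.
  move=> u v; rewrite [in LHS](hcoordK u ha) [in LHS](hcoordK v ha).
  rewrite [in LHS]linear_sumlz [LHS]linear_sum /= {2}/f linear_sumlz.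
  apply: eq_bigr => i _; rewrite linear_sumr [LHS](linear_sum phi) linear_sumr.
  apply: eq_bigr => j _; rewrite !linearZl_LR !linearZr /=.
  rewrite [LHS](linearZ_LR phi) [in LHS](linearZ_LR phi) mul_y;
    congr (_ *: (_ *: _)).
  by apply: eq_bigr => k _; rewrite nth_struct_consts.
have phiG g x : x \in ga_comp A g -> phi x \in ga_comp B g.
  move=> Ax; rewrite /= /f; apply: memv_suml => i _.
  have [<-|nd] := eqVneq (d i) g; first by rewrite memvZ.
  by rewrite (hbasis_hcoord0 ha Ax nd) scale0r mem0v.
exists phi => //; pose L := linfun phi;
  have LE x : L x = phi x by rewrite lfunE.
have kerE x : (x \in lker L) = (phi x == 0) by rewrite memv_ker LE.
have gidL : graded_ideal (lker L).
  apply: (graded_ideal_components ha) => [x z|g x].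
    by rewrite !kerE !phiM => /eqP->; rewrite linear0l linear0r.
  rewrite !kerE => /eqP phi0.
  have hw : homog d (fun i => hcoord a i x *: y i) by move=> i; rewrite memvZ.
  have := homog_sum_eq0 g hw phi0 => comp0; apply/eqP; rewrite -[RHS]comp0.
  by rewrite linear_sum; apply: eq_bigr => i _; rewrite linearZ phi_a.
have ker0 : lker L == 0%VS.
  case: (simpleA.2 _ gidL) => [-> //|kerT].
  by case/eqP: nz_y; have := memvf (a i0); rewrite -kerT kerE phi_a => /eqP.
have limgT : limg L = fullv.
  apply/eqP; rewrite eqEdim subvf dimB -(hbasis_dim ha) /=.
  by rewrite limg_dim_eq // (eqP ker0) capv0.
exists (L^-1)%VF => x; first by rewrite -LE lker0_lfunK.
by rewrite -LE limg_lfunVK // limgT memvf.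
Qed.

(** The inverse preserves degrees: if [y] has degree [g], the component of its
preimage in any other degree is mapped to the corresponding component of [y],
which is zero. *)
Lemma graded_iso_sym A B : graded_iso A B -> graded_iso B A.
Proof.
case=> phi [phiM phiG] [f phiK fK].
have f_lin : linear f := can2_linear phiK fK.
pose psi : {linear B -> A} := HB.pack f (GRing.isLinear.Build _ _ _ _ f f_lin).
exists psi; last by exists phi.
split=> [x y|g y By]; first by apply: (can_inj phiK); rewrite phiM !fK.
have [n [d [a ha]]] := hbasis_exists A.
apply: (hbasis_mem_comp ha) => i nd; set x := psi y.
have hw : homog d (fun j => hcoord a j x *: phi (a j)).
  by move=> j; rewrite memvZ // phiG //; apply: ha.2.
have sum_w : \sum_j hcoord a j x *: phi (a j) = y.
  rewrite -[RHS]fK -[f y]/x [in RHS](hcoordK x ha) linear_sum.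
  by apply: eq_bigr => j _; rewrite linearZ.
have := homog_component (g := g) (d i) hw;
  rewrite sum_w (negPf nd) => /(_ By) comp0.
have : component d a (d i) x = 0.
  apply: (can_inj phiK); rewrite linear0 -[RHS]comp0 linear_sum.
  by apply: eq_bigr => j _; rewrite linearZ.
move/(congr1 (hcoord a i)); rewrite linear0 /component big_mkcond /=.
have -> : \sum_j (if d j == d i then hcoord a j x *: a j else 0) =
    \sum_j (if d j == d i then hcoord a j x else 0) *: a j.
  by apply: eq_bigr => j _; case: ifP; rewrite ?scale0r.
by rewrite (hcoord_sum _ _ ha) eqxx.
Qed.

Lemma graded_iso_identity (X : choiceType) A B (f : freeNA K (X * G)%type) :
  graded_iso A B -> graded_identity B f -> graded_identity A f.
Proof.
case=> phi [phiM phiG] /bij_inj phi_inj idB theta thetaM thetaG.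
apply: phi_inj; rewrite linear0.
apply: (idB (phi \o theta)) => [x y|x g]; first by rewrite /= thetaM phiM.
exact/phiG/thetaG.
Qed.

End Isomorphisms.

Theorem theorem2p6 (K : closedFieldType) (G : semigroupType)
    (X : choiceType) (X_countable : exists e : nat -> X, bijective e)
    (A B : gradedAlg K G) (simpleA : graded_simple A) (simpleB : graded_simple B) :
  graded_iso A B <->
  (forall f : freeNA K (X * G)%type, graded_identity A f <-> graded_identity B f).
Proof.
split=> [isoAB f|idAB].
  by split; apply: graded_iso_identity => //; apply: graded_iso_sym.
have [n [d [a0 ha0]]] := hbasis_exists A.
have [dimB [b hb]] := hbasis_transfer X_countable simpleA simpleB idAB ha0.
have dimA := hbasis_dim ha0.
(* The index [i0] witnesses that the basis is not empty. *)
have [i0 _] := exists_alternating simpleA ha0.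
pose P e := exists2 x : 'I_n -> B, hbasis d x & e = struct_consts x.
pose Q e := exists2 x : 'I_n -> A, hbasis d x & e = struct_consts x.
have [||||_ [a ha ->]] := @constructible_generic K P Q (nonzero_morphism d b).
- by exists (struct_consts b), b.
- move=> p1 p2 r1 r2 [_ [x1 hx1 ->] nz1] [_ [x2 hx2 ->] nz2].
  have [x hx nz] := generic_common hx1 hx2 r1 r2 nz1 nz2.
  by exists (struct_consts x) => //; exists x.
- move=> p rp; split=> [p0 _ [x hx ->]|p0 _ [x hx ->]].
    apply: (vanishing_transfer X_countable simpleA hx (fun f =>
      (idAB f).2) dimB rp).
    by move=> z hz; apply: p0; exists z.
  apply: (vanishing_transfer X_countable simpleB hx (fun f =>
    (idAB f).1) dimA rp).
  by move=> z hz; apply: p0; exists z.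
- by move=> _ [x hx ->]; apply: struct_consts_nonzero_morphism.
case/(holds_nonzero_morphism hb) => y hy struct_y.
exact: iso_of_structure simpleA ha dimB hy struct_y.
Qed.
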